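(* Let $b>a>0$, $0\leq\rho<\frac12<\theta\leq1$, $s\geq0$ and $m\in[1,2]$. Then there is a constant $C>0$, independent of $t$ and $U_0$, such that for every $U_0\in H^s\cap L^m$ the solution $U$ of the Cauchy problem $$U_t+\tfrac12B_0(-\Delta)^{\rho}U+iB_1(-\Delta)^{\frac12}U+\tfrac12B_0(-\Delta)^{\theta}U=0\quad (x\in\mathbb{R}^2,\ t>0),\qquad U(0,x)=U_0(x),$$ satisfies, for all $t\geq0$, $$\|U(t,\cdot)\|_{\dot H^s}\leq C(1+t)^{-\frac{s}{2-2\rho}-\frac{2-m}{m(2-2\rho)}}\|U_0\|_{H^s\cap L^m}.$$
   Context: $U$ and $U_0$ take values in $\mathbb{C}^4$. The coefficient matrices are $$B_0=\begin{pmatrix}1&0&1&0\\0&1&0&1\\1&0&1&0\\0&1&0&1\end{pmatrix},\qquad B_1=\operatorname{diag}(-b,-a,b,a).$$ The solution is given on the Fourier side ($W(t,\xi)$ denotes the Fourier transform of $U(t,\cdot)$ in $x$) by the solution of the ODE system $W_t+\left(\frac12(|\xi|^{2\rho}+|\xi|^{2\theta})B_0+i|\xi|B_1\right)W=0$, $W(0,\xi)=W_0(\xi)$, where $W_0$ is the Fourier transform of $U_0$. $H^s$ and $\dot H^s$ denote the Bessel and Riesz potential spaces on $\mathbb{R}^2$ based on $L^2$, so $\|U\|_{\dot H^s}$ is, up to a constant, $\||\xi|^sW\|_{L^2}$; $\|\cdot\|_{H^s\cap L^m}=\|\cdot\|_{H^s}+\|\cdot\|_{L^m}$. *)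

(* Defs.v *)
From HB Require Import structures.
From mathcomp Require Import all_boot all_order all_algebra.
From mathcomp Require Import complex.
From mathcomp Require Import all_classical all_reals all_analysis.

Set Implicit Arguments.
Unset Strict Implicit.
Unset Printing Implicit Defensive.
Import Order.TTheory GRing.Theory Num.Theory.
Import numFieldNormedType.Exports.

Local Open Scope classical_set_scope.
Local Open Scope ring_scope.

Section Defs.
Context {R : realType}.

Definition plane : Type := (measurableTypeR R * measurableTypeR R)%type.

Definition mu2 := ((@lebesgue_measure R) \x (@lebesgue_measure R))%E.

Definition dotp (x y : plane) : R := x.1 * y.1 + x.2 * y.2.

Definition enorm (x : plane) : R := Num.sqrt (dotp x x).

Definition vec4 : Type := 'cV[R[i]]_4.

Definition vnorm (v : vec4) : R :=
  Num.sqrt (\sum_j (complex.Re (v j 0) ^+ 2 + complex.Im (v j 0) ^+ 2)).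

Definition vmeasurable (u : plane -> vec4) : Prop := forall j,
  measurable_fun setT (fun x => complex.Re (u x j 0)) /\
  measurable_fun setT (fun x => complex.Im (u x j 0)).

Definition Lnorm4 (p : R) (u : plane -> vec4) : \bar R :=
  Lnorm mu2 p%:E (fun x => (vnorm (u x))%:E).

Definition inL (p : R) (u : plane -> vec4) : Prop :=
  vmeasurable u /\ (Lnorm4 p u < +oo)%E.

Definition cintegral (f : plane -> R[i]) : R[i] :=
  Complex (Rintegral mu2 setT (fun x => complex.Re (f x)))
          (Rintegral mu2 setT (fun x => complex.Im (f x))).

(* exp (- i t) *)
Definition expNi (t : R) : R[i] := Complex (cos t) (- sin t).

(* The unitary normalisation in dimension 2, componentwise; meaningful for
   integrable [u] only. *)
Definition fourierL1 (u : plane -> vec4) (xi : plane) : vec4 :=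
  \col_j (real_complex R (2 * pi)^-1 *
          cintegral (fun x => expNi (dotp x xi) * u x j 0)).

Definition truncate (n : nat) (u : plane -> vec4) (x : plane) : vec4 :=
  if enorm x <= n%:R then u x else 0.

(* [w] represents the Fourier-Plancherel transform of [u] in L^2: it is the
   L^2 limit of the Fourier integrals of [u] over the balls of radius n. It is
   determined by [u] up to a null set. *)
Definition is_fourier (u w : plane -> vec4) : Prop :=
  [/\ inL 2 u, vmeasurable w &
      Lnorm4 2 (fun xi => fourierL1 (truncate n u) xi - w xi) @[n --> \oo]
        --> (0 : \bar R)%E].

(* A representative of the Fourier-Plancherel transform of [u]; the default
   value 0 is only taken when [u] is not in L^2. *)
Definition fourier (u : plane -> vec4) : plane -> vec4 :=
  xget (fun=> 0) [set w | is_fourier u w].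

Definition Hnorm (s : R) (u : plane -> vec4) : \bar R :=
  Lnorm4 2 (fun xi =>
    real_complex R ((1 + enorm xi ^+ 2) `^ (s / 2)) *: fourier u xi).

(* For [s >= 0], where H^s is a subspace of L^2. *)
Definition inH (s : R) (u : plane -> vec4) : Prop :=
  inL 2 u /\ (Hnorm s u < +oo)%E.

(* For [u] in L^2. *)
Definition dotHnorm (s : R) (u : plane -> vec4) : \bar R :=
  Lnorm4 2 (fun xi => real_complex R (enorm xi `^ s) *: fourier u xi).

Definition B0 : 'M[R[i]]_4 := \matrix_(j, k)
  (nth [::] [:: [:: 1; 0; 1; 0];
                [:: 0; 1; 0; 1];
                [:: 1; 0; 1; 0];
                [:: 0; 1; 0; 1]] j)`_k.

Definition B1 (a b : R) : 'M[R[i]]_4 :=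
  diag_mx (\row_j real_complex R [:: - b; - a; b; a]`_j).

Definition symbol (a b rho theta : R) (xi : plane) : 'M[R[i]]_4 :=
  real_complex R (2^-1 * (enorm xi `^ (2 * rho) + enorm xi `^ (2 * theta)))
    *: B0
  + ('i%C * real_complex R (enorm xi)) *: B1 a b.

Definition vcontinuous_within (A : set R) (w : R -> vec4) : Prop := forall j,
  {within A, continuous (fun t => complex.Re (w t j 0))} /\
  {within A, continuous (fun t => complex.Im (w t j 0))}.

Definition is_vderive (w : R -> vec4) (t : R) (d : vec4) : Prop := forall j,
  is_derive t (1 : R) (fun r => complex.Re (w r j 0)) (complex.Re (d j 0)) /\
  is_derive t (1 : R) (fun r => complex.Im (w r j 0)) (complex.Im (d j 0)).

(* w' + A w = 0 for t > 0, with w 0 = w0 and w continuous on [0, +oo[ *)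
Definition solves_ode (A : 'M[R[i]]_4) (w0 : vec4) (w : R -> vec4) : Prop :=
  [/\ w 0 = w0, vcontinuous_within (`[0, +oo[%classic) w &
      forall t, 0 < t -> is_vderive w t (- (A *m w t))].

(* The values of [U] and [W] at negative times play no role. *)
Definition is_solution (a b rho theta : R) (U0 : plane -> vec4)
    (U : R -> plane -> vec4) : Prop :=
  exists (W0 : plane -> vec4) (W : R -> plane -> vec4),
    [/\ is_fourier U0 W0,
        forall t, 0 <= t -> is_fourier (U t) (W t) &
        {ae mu2, forall xi, solves_ode (symbol a b rho theta xi)
                              (W0 xi) (fun t => W t xi)}].

End Defs.

(* Main.v *)
(** On the Fourier side the system splits into the coordinate pairs (1,3) and
    (2,4).  With p, q the sum and difference of a pair, h the dissipation
    and beta = a|xi| or b|xi| the speed, p' = -2hp + i beta q and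
    q' = i beta p; the functional |p|^2 + |q|^2 + 2k Re(i p conj(q)) with
    k = h beta / (4 (h^2 + beta^2)) decays at a rate comparable to
    h beta^2 / (h^2 + beta^2), that is |xi|^(2 - 2 rho) for |xi| <= 1, and
    bounded below for |xi| >= 1.  High frequencies thus decay exponentially
    in H^s.

    At low frequencies, |xi|^(2s) exp(-c |xi|^(2 - 2 rho) T) |W0|^2 is
    integrated without the Hausdorff-Young inequality: U0 is cut at a height
    lam.  The part above lam is in L^1, so its transform is bounded and the
    weight is integrated; the part below lam is in L^2, so the weight is
    bounded by its supremum and the Plancherel inequality applies.  Both
    contributions have the sharp order when lam is tuned to T and ||U0||_m.

    The Plancherel inequality for bounded functions of bounded support is
    Bessel's inequality for the characters of a large square, at frequencies
    in a shifted lattice, integrated over the shifts in one cell. *)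

(* The transform is a limit of truncated Fourier integrals, so each estimate is proved for a
   truncation with constants independent of its radius; weights are kept bounded so that the [L^2]
   error of the limit stays harmless. The cut at height [lam] is interpolation by hand between the
   bounds from [L^1] to [L^oo] and from [L^2] to [L^2]. A single [lam] suffices because it may
   depend on the data. With [tau = T^(1/(2 - 2 rho))], the low-frequency weight lies below a
   multiple of [tau^(-2s) (1 + (tau |xi|)^2)^(-2)], hence below a product of functions of one
   variable, whose integral is elementary. The parameter [k] has to stay below [beta / (4 h)],
   [h / (4 beta)] and [1 / 8]; the formula chosen meets all three bounds whichever of [h] and [beta]
   dominates. The rate used is capped at a constant [c], so passing from [t] to [T = 1 + t] costs a
   factor [exp c], and small times need no separate argument. *)
From HB Require Import structures.
Require Import Defs.
From mathcomp Require Import all_boot all_order all_algebra.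
From mathcomp Require Import complex.
From mathcomp Require Import all_classical all_reals all_analysis.
From mathcomp Require Import measurable_realfun.
From mathcomp Require Import ring lra.

Set Implicit Arguments.
Unset Strict Implicit.
Unset Printing Implicit Defensive.
Import Order.TTheory GRing.Theory Num.Theory.
Import numFieldNormedType.Exports.
Local Open Scope ring_scope.
Local Open Scope classical_set_scope.

(** * Translation invariance and Bessel's inequality *)

Section Plane.
Context {R : realType}.
Local Notation mu := (@lebesgue_measure R).

(** Lebesgue measure is determined by its values on half-open intervals, and a translation pulls
    such an interval back to one of the same length. *)
Lemma lebesgue_measure_shift (a : R) (A : set R) : measurable A ->
  pushforward mu ((fun x => x + a) : _ -> measurableTypeR R) A = mu A.
Proof.
move=> mA.
have mf : measurable_fun (setT : set (measurableTypeR R))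
    ((fun x => x + a) : measurableTypeR R -> measurableTypeR R).
  exact: measurable_funD.
pose f : {mfun measurableTypeR R >-> measurableTypeR R} :=
  @mfun_Sub _ _ (measurableTypeR R) (measurableTypeR R) _ (mem_set mf).
rewrite (_ : pushforward _ _ = pushforward mu f)//.
apply/esym/lebesgue_measure_unique => //= _ [[x y]] _ <-.
rewrite /pushforward (_ : _ @^-1` _ = `]x - a, y - a]%classic).
  rewrite !lebesgue_measure_itv/= !lte_fin ltrD2r.
  by case: ifP => // _; congr _%:E; ring.
by apply/seteqP; split => z /=; rewrite !in_itv/= ltrBlDr lerBrDr.
Qed.

Lemma ge0_integral_shift (a : R) (D : set R) (f : R -> \bar R) :
  measurable D -> measurable_fun setT f -> (forall x, 0 <= f x)%E ->
  (\int[mu]_(x in D) f x = \int[mu]_(x in [set x | D (x + a)%R]) f (x + a)%R)%E.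
Proof.
move=> mD mf f0.
have mg : measurable_fun (setT : set (measurableTypeR R))
    ((fun x => x + a) : measurableTypeR R -> measurableTypeR R).
  exact: measurable_funD.
pose g : {mfun measurableTypeR R >-> measurableTypeR R} :=
  @mfun_Sub _ _ (measurableTypeR R) (measurableTypeR R) _ (mem_set mg).
have := @ge0_integral_pushforward _ _ _ _ _ g mg mu D f mD.
rewrite /= => <-//; last exact: measurable_funTS.
by apply: eq_measure_integral => A mA _; rewrite -[LHS](lebesgue_measure_shift a).
Qed.

(** Half-open tiles are disjoint and fill the interval exactly; each is translated back to [[0, w[].
    Read from right to left, this integrates a lattice sum over the shifts in one cell. *)
Lemma ge0_integral_tile (a w : R) (n : nat) (f : R -> \bar R) :
  0 <= w -> measurable_fun setT f -> (forall x, 0 <= f x)%E ->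
  (\int[mu]_(x in `[a, (a + w *+ n)%R[) f x =
   \int[mu]_(x in `[0%R, w[) \sum_(i < n) f (x + (a + w *+ i))%R)%E.
Proof.
move=> w0 mf f0.
rewrite ge0_integral_sum//; last first.
  move=> i _; apply: measurableT_comp => //.
  by apply/measurable_funTS; exact: measurable_funD.
elim: n => [|n IH].
  by rewrite big_ord0 mulr0n addr0 set_itvco0 integral_set0.
rewrite big_ord_recr/= -IH.
have -> : `[a, a + w *+ n.+1[%classic =
          `[a, a + w *+ n[%classic `|` `[a + w *+ n, a + w *+ n.+1[%classic.
  rewrite -itv_bndbnd_setU//= ?bnd_simp ?lerDl ?mulrn_wge0//.
  by rewrite lerD2l mulrSr lerDl.
rewrite ge0_integral_setU//; last 2 first.
- exact: measurable_funTS.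
- apply/disj_setPRL => x/=; rewrite !in_itv/= => /andP[h _] /andP[_].
  by rewrite ltNge h.
congr (_ + _)%E.
rewrite (ge0_integral_shift (a + w *+ n))//; congr integral.
apply/seteqP; split => x /=; rewrite !in_itv/= mulrSr addrA; lra.
Qed.

Lemma ge0_integral_setX d1 d2 (T1 : measurableType d1) (T2 : measurableType d2)
    (m1 : {sigma_finite_measure set T1 -> \bar R})
    (m2 : {sigma_finite_measure set T2 -> \bar R})
    (A : set T1) (B : set T2) (f : T1 * T2 -> \bar R) :
  measurable A -> measurable B -> measurable_fun setT f ->
  (forall x, 0 <= f x)%E ->
  (\int[m1 \x m2]_(z in A `*` B) f z =
   \int[m1]_(x in A) \int[m2]_(y in B) f (x, y))%E.
Proof.
move=> mA mB mf f0.
rewrite integral_mkcond fubini_tonelli1; last 2 first.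
- apply/(measurable_restrictT f); first exact: measurableX.
  exact: measurable_funTS.
- by move=> x; rewrite patchE; case: ifP.
rewrite [RHS]integral_mkcond; apply: eq_integral => x _.
rewrite /fubini_F !patchE; case: ifPn => xA.
  rewrite [RHS]integral_mkcond; apply: eq_integral => y _.
  by rewrite !patchE in_setX xA.
by apply: integral0_eq => y _; rewrite patchE in_setX (negbTE xA).
Qed.

End Plane.

Section BoundedMeasurable.
Context d (T : measurableType d) (R : realType).
Implicit Types f g : T -> R.

(** This class is stable under sums and products and integrable on sets of finite measure, which
    settles every integrability condition in Bessel's inequality uniformly. *)
Definition bmf f := measurable_fun setT f /\ exists M, forall x, `|f x| <= M.

Lemma bmf_cst (c : R) : bmf (fun=> c).
Proof. by split=> //; exists `|c|. Qed.

Lemma bmfD f g : bmf f -> bmf g -> bmf (fun x => f x + g x).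
Proof.
move=> [mf [M fM]] [mg [N gN]]; split; first exact: measurable_funD.
by exists (M + N) => x; rewrite (le_trans (ler_normD _ _))// lerD.
Qed.

Lemma bmfN f : bmf f -> bmf (fun x => - f x).
Proof.
move=> [mf [M fM]]; split; first exact: measurable_funN.
by exists M => x; rewrite normrN.
Qed.

Lemma bmfB f g : bmf f -> bmf g -> bmf (fun x => f x - g x).
Proof. by move=> bf bg; apply: bmfD => //; exact: bmfN. Qed.

Lemma bmfM f g : bmf f -> bmf g -> bmf (fun x => f x * g x).
Proof.
move=> [mf [M fM]] [mg [N gN]]; split; first exact: measurable_funM.
by exists (M * N) => x; rewrite normrM ler_pM.
Qed.

Lemma bmfX f n : bmf f -> bmf (fun x => f x ^+ n).
Proof.
by move=> bf; elim: n => [|n IH];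
  [exact: bmf_cst|under eq_fun do rewrite exprS; exact: bmfM].
Qed.

Lemma bmf_sum I (r : seq I) (F : I -> T -> R) :
  (forall i, bmf (F i)) -> bmf (fun x => \sum_(i <- r) F i x).
Proof.
move=> bF; elim: r => [|i r IH].
  by under eq_fun do rewrite big_nil; exact: bmf_cst.
by under eq_fun do rewrite big_cons; exact: bmfD.
Qed.

Lemma bmf_integrable (mu : {measure set T -> \bar R}) (D : set T) f :
  measurable D -> (mu D < +oo)%E -> bmf f -> mu.-integrable D (EFin \o f).
Proof.
move=> mD Doo [mf [M fM]]; apply: measurable_bounded_integrable => //.
  exact: measurable_funTS.
exists M; split; first by rewrite num_real.
by move=> N MN x _ /=; exact: le_trans (fM x) (ltW MN).
Qed.

Lemma Rintegral_sum (mu : {measure set T -> \bar R}) (D : set T) I (r : seq I)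
    (F : I -> T -> R) : measurable D ->
  (forall i, mu.-integrable D (EFin \o F i)) ->
  (\int[mu]_(x in D) (\sum_(i <- r) F i x) =
   \sum_(i <- r) \int[mu]_(x in D) F i x)%R.
Proof.
move=> mD iF.
have iS s : mu.-integrable D (EFin \o (fun x => \sum_(i <- s) F i x)).
  rewrite (_ : _ \o _ = fun x => (\sum_(i <- s) (F i x)%:E)%E).
    by apply: integrable_sum => // i _; exact: iF.
  by apply/funext => x /=; rewrite sumEFin.
elim: r => [|i r IH].
  by under eq_Rintegral do rewrite big_nil; rewrite Rintegral_cst// mul0r big_nil.
under eq_Rintegral do rewrite big_cons.
by rewrite RintegralD// IH big_cons.
Qed.

End BoundedMeasurable.

(* [c i] and [s i] play the roles of the real and imaginary parts of a family
   of characters e_i; the two hypotheses are the real and imaginary parts of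
   <e_i, e_j> = K delta_ij. *)
Lemma bessel_inequality d (T : measurableType d) (R : realType)
    (mu : {measure set T -> \bar R}) (D : set T) (I : finType)
    (c s : I -> T -> R) (g : T -> R) (K : R) :
  measurable D -> (mu D < +oo)%E -> 0 < K ->
  (forall i, bmf (c i)) -> (forall i, bmf (s i)) -> bmf g ->
  (forall i j, \int[mu]_(x in D) (c i x * c j x + s i x * s j x) =
               if i == j then K else 0) ->
  (forall i j, \int[mu]_(x in D) (s i x * c j x - c i x * s j x) = 0) ->
  \sum_i ((\int[mu]_(x in D) (g x * c i x)) ^+ 2 +
          (\int[mu]_(x in D) (g x * s i x)) ^+ 2) <=
  K * \int[mu]_(x in D) (g x ^+ 2).
Proof.
move=> mD Doo K0 bc bs bg ocs osc.
have int f : bmf f -> mu.-integrable D (EFin \o f) by exact: bmf_integrable.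
pose A i := \int[mu]_(x in D) (g x * c i x).
pose B i := \int[mu]_(x in D) (g x * s i x).
pose Q := \sum_i (A i ^+ 2 + B i ^+ 2).
(* With [e_i = c_i + i s_i], the coefficient of [g] along [e_i] is [A_i - i B_i], so [P + i P'] is
   [K] times the orthogonal projection of [g] onto the span of the characters. *)
pose P x := \sum_i (A i * c i x + B i * s i x).
pose P' x := \sum_i (A i * s i x - B i * c i x).
have bAc (u v : T -> R) (a b : R) : bmf u -> bmf v ->
    bmf (fun x => a * u x + b * v x).
  by move=> bu bv; apply: bmfD; apply: bmfM => //; exact: bmf_cst.
have bP : bmf P by apply: bmf_sum => i; exact: bAc.
have bP' : bmf P'.
  apply: bmf_sum => i; apply: bmfB; apply: bmfM => //; exact: bmf_cst.
have gP : \int[mu]_(x in D) (g x * P x) = Q.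
  under eq_Rintegral do rewrite /P mulr_sumr.
  rewrite Rintegral_sum//; last first.
    by move=> i; apply: int; apply: bmfM => //; exact: bAc.
  apply: eq_bigr => i _.
  under eq_Rintegral do rewrite mulrDr !(mulrCA (g _)).
  rewrite RintegralD//; last 2 first.
  - by apply: int; apply: bmfM; [exact: bmf_cst|exact: bmfM].
  - by apply: int; apply: bmfM; [exact: bmf_cst|exact: bmfM].
  by rewrite !RintegralZl//; apply: int; exact: bmfM.
have PP : \int[mu]_(x in D) (P x ^+ 2 + P' x ^+ 2) = K * Q.
  have E x : P x ^+ 2 + P' x ^+ 2 = \sum_i \sum_j
      ((A i * A j + B i * B j) * (c i x * c j x + s i x * s j x) +
       (B i * A j - A i * B j) * (s i x * c j x - c i x * s j x)).
    rewrite !expr2 /P /P' !big_distrlr/= -big_split; apply: eq_bigr => i _ /=.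
    by rewrite -big_split; apply: eq_bigr => j _ /=; ring.
  under eq_Rintegral do rewrite E.
  have bcc i j : bmf (fun x => c i x * c j x + s i x * s j x).
    by apply: bmfD; exact: bmfM.
  have bsc i j : bmf (fun x => s i x * c j x - c i x * s j x).
    by apply: bmfB; exact: bmfM.
  rewrite Rintegral_sum//; last first.
    by move=> i; apply: int; apply: bmf_sum => j; exact: bAc.
  rewrite /Q mulr_sumr; apply: eq_bigr => i _.
  rewrite Rintegral_sum//; last by move=> j; apply: int; exact: bAc.
  under eq_bigr => j _.
    rewrite RintegralD//; last 2 first.
    - by apply: int; apply: bmfM => //; exact: bmf_cst.
    - by apply: int; apply: bmfM => //; exact: bmf_cst.
    rewrite !RintegralZl//; [|exact: int..].
    rewrite ocs osc mulr0 addr0.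
    over.
  rewrite (bigD1 i)//= eqxx big1 ?addr0; first by rewrite !expr2 mulrC.
  by move=> j ji; rewrite eq_sym (negbTE ji) mulr0.
(* This is the squared distance from [g] to its projection; by [gP] and [PP] it equals the integral
   of [g^2] minus [Q / K]. *)
have : 0 <= \int[mu]_(x in D) ((g x - K^-1 * P x) ^+ 2 + (K^-1 * P' x) ^+ 2).
  by apply: Rintegral_ge0 => x _; rewrite addr_ge0// sqr_ge0.
have -> : \int[mu]_(x in D) ((g x - K^-1 * P x) ^+ 2 + (K^-1 * P' x) ^+ 2) =
    \int[mu]_(x in D) (g x ^+ 2 + ((- 2 * K^-1) * (g x * P x) +
      (K^-1 ^+ 2 * (P x ^+ 2 + P' x ^+ 2)))).
  by apply: eq_Rintegral => x _; ring.
have b1 : bmf (fun x => - 2 * K^-1 * (g x * P x)).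
  by apply: bmfM; [exact: bmf_cst|exact: bmfM].
have b2 : bmf (fun x => P x ^+ 2 + P' x ^+ 2) by apply: bmfD; exact: bmfX.
have b3 : bmf (fun x => K^-1 ^+ 2 * (P x ^+ 2 + P' x ^+ 2)).
  by apply: bmfM => //; exact: bmf_cst.
rewrite RintegralD//; [|exact/int/bmfX|exact/int/bmfD].
rewrite RintegralD//; [|exact/int|exact/int].
rewrite !RintegralZl//; [|exact/int|by apply/int; exact: bmfM].
rewrite gP PP -/Q -ler_pdivrMl//.
set J := \int[mu]_(x in D) _.
suff -> : J + (- 2 * K^-1 * Q + K^-1 ^+ 2 * (K * Q)) = J - K^-1 * Q.
  by rewrite subr_ge0.
by field; rewrite gt_eqF.
Qed.

Section RestrictedFubini.
Context d1 d2 (T1 : measurableType d1) (T2 : measurableType d2) (R : realType).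
Context (m1 : {sigma_finite_measure set T1 -> \bar R}).
Context (m2 : {sigma_finite_measure set T2 -> \bar R}).
Implicit Types (A : set T1) (B : set T2) (f : T1 * T2 -> \bar R).

(** Both orders of integration are recorded because orthogonality of characters is obtained by
    integrating first in a coordinate whose frequency does not vanish. *)
Lemma integral_setX12 A B f : measurable A -> measurable B ->
  (m1 \x m2)%E.-integrable (A `*` B) f ->
  (\int[m1 \x m2]_(z in A `*` B) f z =
   \int[m1]_(x in A) \int[m2]_(y in B) f (x, y))%E.
Proof.
move=> mA mB intf; rewrite integral_mkcond -integral12_prod_meas1//; last first.
  exact: (integrable_mkcond f (measurableX mA mB)).1 intf.
rewrite [RHS]integral_mkcond; apply: eq_integral => x _.
rewrite /fubini_F !patchE; case: ifPn => xA.
  rewrite [RHS]integral_mkcond; apply: eq_integral => y _.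
  by rewrite !patchE in_setX xA.
by apply: integral0_eq => y _; rewrite patchE in_setX (negbTE xA).
Qed.

Lemma integral_setX21 A B f : measurable A -> measurable B ->
  (m1 \x m2)%E.-integrable (A `*` B) f ->
  (\int[m1 \x m2]_(z in A `*` B) f z =
   \int[m2]_(y in B) \int[m1]_(x in A) f (x, y))%E.
Proof.
move=> mA mB intf; rewrite integral_mkcond -integral21_prod_meas1//; last first.
  exact: (integrable_mkcond f (measurableX mA mB)).1 intf.
rewrite [RHS]integral_mkcond; apply: eq_integral => y _.
rewrite /fubini_G !patchE; case: ifPn => yB.
  rewrite [RHS]integral_mkcond; apply: eq_integral => x _.
  by rewrite !patchE in_setX yB andbT.
by apply: integral0_eq => x _; rewrite patchE in_setX (negbTE yB) andbF.
Qed.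

End RestrictedFubini.

(** * Plancherel inequality *)

Section Trig.
Context {R : realType}.
Local Notation mu := (@lebesgue_measure R).
Implicit Types (p a b c : R) (g : plane (R := R) -> R) (xi : plane (R := R)).

Lemma measurable_cos : measurable_fun setT (@cos R).
Proof. by apply: continuous_measurable_fun; exact: continuous_cos. Qed.

Lemma measurable_sin : measurable_fun setT (@sin R).
Proof. by apply: continuous_measurable_fun; exact: continuous_sin. Qed.

Lemma sin_pi_mulrn (n : nat) c : sin (pi *+ n + c) = sin (- (pi *+ n) + c).
Proof.
rewrite -(periodicn (@sinD2pi R) n (- (pi *+ n) + c)); congr sin.
have -> : pi *+ 2 *+ n = pi *+ n + pi *+ n :> R.
  by rewrite -mulrnA mulnC mulrnA mulr2n.
by rewrite [RHS]addrA [X in _ = X + _]addrAC addNr add0r addrC.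
Qed.

(** The interval is a whole number of periods long, so the antiderivative agrees at both ends. The
    phase [c] carries the contribution of the other coordinate and, shifted by a quarter turn,
    yields the sine. *)
Lemma integral_cos_period p a c (n : nat) : 0 < p -> a != 0 ->
  a * p = pi *+ n \/ a * p = - (pi *+ n) ->
  (\int[mu]_(x in `[(- p)%R, p]) (cos (a * x + c))%:E = 0)%E.
Proof.
move=> p0 a0 ap.
have dF (x : R) : is_derive x (1 : R) (fun x => a^-1 * sin (a * x + c))
    (cos (a * x + c)).
  apply: is_derive_eq.
  by rewrite addr0 /GRing.scale/= mulr1 mulrCA mulVf// mulr1.
have pp : - p < p by lra.
have cF : continuous (fun x => a^-1 * sin (a * x + c)).
  move=> x; apply: differentiable_continuous; apply/derivable1_diffP.
  by apply: ex_derive; exact: dF.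
rewrite (@continuous_FTC2 _ _ (fun x => a^-1 * sin (a * x + c)))//.
- rewrite -EFinB -mulrBr mulrN.
  case: ap => ->; first by rewrite sin_pi_mulrn subrr mulr0.
  by rewrite opprK -sin_pi_mulrn subrr mulr0.
- apply: continuous_subspaceT => x.
  apply: continuous_comp; last exact: continuous_cos.
  apply: cvgD; last exact: cvg_cst.
  by apply: cvgM; [exact: cvg_cst|exact: cvg_id].
- split; first by move=> x _; apply: ex_derive; exact: dF.
  + by apply: cvg_at_right_filter; exact: cF.
  + by apply: cvg_at_left_filter; exact: cF.
- by move=> x _; rewrite derive1E; have := dF x => /@derive_val.
Qed.

Lemma bmf_cos_dotp xi (c : R) : bmf (fun x => cos (dotp x xi + c)).
Proof.
split; last first.
  by exists 1 => x; rewrite ler_norml cos_geN1 cos_le1.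
apply: (measurableT_comp measurable_cos).
apply: measurable_funD => //; apply: measurable_funD.
- by apply: measurable_funM => //; exact: measurable_fst.
- by apply: measurable_funM => //; exact: measurable_snd.
Qed.

Lemma bmf_sin_dotp xi (c : R) : bmf (fun x => sin (dotp x xi + c)).
Proof.
under eq_fun do rewrite -cosBpihalf -addrA.
exact: bmf_cos_dotp.
Qed.

Definition box p : set (plane (R := R)) := `[- p, p] `*` `[- p, p].

Lemma measurable_box p : measurable (box p).
Proof. by apply: measurableX; exact: measurable_itv. Qed.

Lemma mu2_box p : 0 <= p -> mu2 (box p) = (((2 * p) ^+ 2)%:E)%E.
Proof.
move=> p0; rewrite /mu2 /box product_measure1E; [|exact: measurable_itv..].
transitivity (mu `[(- p)%R, p]%classic * mu `[(- p)%R, p]%classic)%E => //.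
rewrite !lebesgue_measure_itv/= lte_fin.
have [pp|pp] := ltrP (- p) p; first by rewrite -EFinB -EFinM expr2; congr EFin; lra.
have -> : p = 0 by lra.
by rewrite mule0 mulr0 expr0n.
Qed.

Lemma mu2_box_lty p : 0 <= p -> (mu2 (box p) < +oo)%E.
Proof. by move=> p0; rewrite mu2_box ?ltry. Qed.

Lemma integral_cos_box p xi c (m n : nat) : 0 < p ->
  xi.1 * p = pi *+ m \/ xi.1 * p = - (pi *+ m) ->
  xi.2 * p = pi *+ n \/ xi.2 * p = - (pi *+ n) ->
  (xi.1 != 0) || (xi.2 != 0) ->
  \int[mu2]_(x in box p) cos (dotp x xi + c) = 0.
Proof.
move=> p0 h1 h2 h.
have int : mu2.-integrable (box p) (EFin \o (fun x => cos (dotp x xi + c))).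
  apply: bmf_integrable; [exact: measurable_box| |exact: bmf_cos_dotp].
  by apply: mu2_box_lty; exact: ltW.
rewrite /Rintegral (_ : integral _ _ _ = 0%E)//.
have [xi1|xi1] := eqVneq xi.1 0; move: h; rewrite ?xi1 ?eqxx/= => xi2.
  rewrite integral_setX12//; [|exact: measurable_itv..].
  apply: integral0_eq => x _.
  under eq_integral do rewrite /dotp/= -addrA addrCA (mulrC _ xi.2).
  exact: (integral_cos_period _ _ xi2 h2).
rewrite integral_setX21//; [|exact: measurable_itv..].
apply: integral0_eq => x _.
under eq_integral do rewrite /dotp/= -addrA (mulrC _ xi.1).
exact: (integral_cos_period _ _ xi1 h1).
Qed.

Definition cos_transform g xi : R := \int[mu2]_x (g x * cos (dotp x xi)).

Definition sin_transform g xi : R := \int[mu2]_x (g x * sin (dotp x xi)).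

(* For a real function, the squared modulus of the transform, unnormalised. *)
Definition fsq g xi : R := cos_transform g xi ^+ 2 + sin_transform g xi ^+ 2.

(** The box has side [2 pi L], so frequencies spaced by [1 / L] give orthogonal characters on it, of
    squared norm equal to its area. Orthogonality depends on differences of frequencies only, hence
    the arbitrary shift [xi]. *)
Lemma fsq_lattice_le g (L : R) (n : nat) xi : 0 < L -> bmf g ->
  (forall x, ~ box (pi * L) x -> g x = 0) ->
  \sum_(k : 'I_n * 'I_n) fsq g (xi.1 + k.1%:R / L, xi.2 + k.2%:R / L) <=
  (2 * (pi * L)) ^+ 2 * \int[mu2]_(x in box (pi * L)) (g x ^+ 2).
Proof.
move=> L0 bg g0.
have p0 : 0 < pi * L :> R by rewrite mulr_gt0// pi_gt0.
pose z (k : 'I_n * 'I_n) : plane := (xi.1 + k.1%:R / L, xi.2 + k.2%:R / L).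
have restr (h : plane -> R) :
    \int[mu2]_x (g x * h x) = \int[mu2]_(x in box (pi * L)) (g x * h x).
  rewrite [RHS]Rintegral_mkcond; apply: eq_Rintegral => x _.
  by rewrite patchE; case: ifPn => // /negP; rewrite inE => /g0 ->; rewrite mul0r.
under eq_bigr do rewrite /fsq /cos_transform /sin_transform !restr.
pose dz i j : plane := ((z i).1 - (z j).1, (z i).2 - (z j).2).
have dzE x i j : dotp x (z i) - dotp x (z j) = dotp x (dz i j).
  by rewrite /dotp/=; ring.
(* The multiple of [pi] is a natural number, so the order of [u] and [v] decides the sign. *)
have zper (u v : 'I_n) (w : R) : exists k : nat,
    (w + u%:R / L - (w + v%:R / L)) * (pi * L) = pi *+ k \/
    (w + u%:R / L - (w + v%:R / L)) * (pi * L) = - (pi *+ k).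
  have -> : (w + u%:R / L - (w + v%:R / L)) * (pi * L) = pi * (u%:R - v%:R).
    by field; rewrite gt_eqF.
  have [uv|/ltnW uv] := leqP v u.
    by exists (u - v)%N; left; rewrite -natrB// mulr_natr.
  by exists (v - u)%N; right; rewrite -opprB -natrB// mulrN mulr_natr.
have int0 i j c : i != j ->
    \int[mu2]_(x in box (pi * L)) cos (dotp x (dz i j) + c) = 0.
  move=> ij.
  have [m h1] := zper i.1 j.1 xi.1; have [k h2] := zper i.2 j.2 xi.2.
  apply: (@integral_cos_box _ (dz i j) _ _ _ p0 h1 h2); rewrite /dz /z/=.
  have neq (u v : 'I_n) (w : R) : (w + u%:R / L - (w + v%:R / L) != 0) = (u != v).
    have -> : w + u%:R / L - (w + v%:R / L) = (u%:R - v%:R) / L by ring.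
    rewrite mulf_eq0 invr_eq0 (gt_eqF L0) orbF subr_eq0 eqr_nat.
    by [].
  rewrite !neq; apply: contraNT ij; rewrite negb_or !negbK => /andP[/eqP e1 /eqP e2].
  by rewrite (surjective_pairing i) (surjective_pairing j) e1 e2.
apply: (bessel_inequality (c := fun k x => cos (dotp x (z k)))
    (s := fun k x => sin (dotp x (z k)))) => //.
- exact: measurable_box.
- by apply: mu2_box_lty; exact: ltW.
- by rewrite exprn_gt0// mulr_gt0.
- by move=> i; have := bmf_cos_dotp (z i) 0; under eq_fun do rewrite addr0.
- by move=> i; have := bmf_sin_dotp (z i) 0; under eq_fun do rewrite addr0.
- move=> i j; under eq_Rintegral do rewrite -cosB dzE.
  have [<-|ij] := eqVneq i j; last first.
    by rewrite -(int0 i j 0 ij); under [RHS]eq_Rintegral do rewrite addr0.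
  under eq_Rintegral do rewrite /dotp/= !subrr !mulr0 addr0 cos0.
  rewrite Rintegral_cst; last exact: measurable_box.
  by rewrite mul1r -[RHS]/(fine _%:E) -(mu2_box (ltW p0)).
- move=> i j; under eq_Rintegral do rewrite -sinB dzE.
  have [<-|ij] := eqVneq i j; last first.
    by rewrite -(int0 i j (- (pi / 2)) ij); apply: eq_Rintegral => x _; rewrite cosBpihalf.
  under eq_Rintegral do rewrite /dotp/= !subrr !mulr0 addr0 sin0.
  by rewrite Rintegral_cst ?mul0r//; exact: measurable_box.
Qed.

End Trig.

Lemma sigma_finite_mu2 (R : realType) : sigma_finite setT (@mu2 R).
Proof.
exists (fun n => box n%:R); last first.
  move=> n; split; first exact: measurable_box.
  exact: mu2_box_lty.
apply/seteqP; split => // -[x y] _.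
exists (Num.truncn (`|x| + `|y|)).+1 => //.
have xy : `|x| + `|y| < (Num.truncn (`|x| + `|y|)).+1%:R by exact: truncnS_gt.
have x0 := normr_ge0 x; have y0 := normr_ge0 y.
have : `|x| <= (Num.truncn (`|x| + `|y|)).+1%:R by lra.
have : `|y| <= (Num.truncn (`|x| + `|y|)).+1%:R by lra.
by rewrite !ler_norml => ? ?; split; rewrite /= in_itv.
Qed.

(* The measure inferred for [mu2] is not recognised as sigma-finite. *)
HB.instance Definition _ (R : realType) :=
  Measure.copy (@mu2 R) (@lebesgue_measure R \x @lebesgue_measure R)%E.
HB.instance Definition _ (R : realType) :=
  @Measure_isSigmaFinite.Build _ _ R (@mu2 R) (@sigma_finite_mu2 R).

(** Tonelli gives measurability of the integrals of the positive and negative parts; their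
    difference stays measurable through [fine], whether or not it is finite. *)
Lemma measurable_Rintegral_param d1 d2 (T1 : measurableType d1)
    (T2 : measurableType d2) (R : realType)
    (m : {sigma_finite_measure set T2 -> \bar R}) (f : T1 * T2 -> R) :
  measurable_fun setT f -> measurable_fun setT (fun x => \int[m]_y f (x, y)).
Proof.
move=> mf; apply: (measurableT_comp (fine_measurable measurableT)).
under eq_fun do rewrite integralE.
have mEf : measurable_fun setT (EFin \o f) by exact/measurable_EFinP.
apply: emeasurable_funB.
- rewrite (_ : (fun x => _) = fubini_F m (EFin \o f)^\+%E).
    by apply: measurable_fun_fubini_tonelli_F => //; exact: measurable_funepos.
  by apply/funext => x; apply: eq_integral => y _; rewrite !funeposE.
- rewrite (_ : (fun x => _) = fubini_F m (EFin \o f)^\-%E).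
    by apply: measurable_fun_fubini_tonelli_F => //; exact: measurable_funeneg.
  by apply/funext => x; apply: eq_integral => y _; rewrite !funenegE.
Qed.

Lemma measurable_ge0_integral_param d1 d2 (T1 : measurableType d1)
    (T2 : measurableType d2) (R : realType)
    (m : {sigma_finite_measure set T2 -> \bar R}) (D : set T2)
    (f : T1 * T2 -> \bar R) : measurable D ->
  measurable_fun setT f -> (forall z, 0 <= f z)%E ->
  measurable_fun setT (fun x => \int[m]_(y in D) f (x, y))%E.
Proof.
move=> mD mf f0.
rewrite (_ : (fun x => _) = fubini_F m (f \_ (setT `*` D))).
  apply: measurable_fun_fubini_tonelli_F.
    apply/(measurable_restrictT f); first exact: measurableX.
    exact: measurable_funTS.
  by move=> z; rewrite patchE; case: ifP.
apply/funext => x; rewrite integral_mkcond; apply: eq_integral => y _.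
by rewrite !patchE in_setX/= in_setT.
Qed.

Section Plancherel.
Context {R : realType}.
Local Notation mu := (@lebesgue_measure R).
Local Notation plane := (plane (R := R)).
Implicit Types (p : R) (g : plane -> R).

Let mus : {sigma_finite_measure set (measurableTypeR R) -> \bar R} :=
  @lebesgue_measure R.

Lemma measurable_dotp : measurable_fun setT (fun z : plane * plane => dotp z.2 z.1).
Proof.
have m1 : measurable_fun setT (fun z : plane * plane => z.1) by exact: measurable_fst.
have m2 : measurable_fun setT (fun z : plane * plane => z.2) by exact: measurable_snd.
apply: measurable_funD; apply: measurable_funM.
- exact: (measurableT_comp measurable_fst m2).
- exact: (measurableT_comp measurable_fst m1).
- exact: (measurableT_comp measurable_snd m2).
- exact: (measurableT_comp measurable_snd m1).
Qed.

Lemma measurable_cos_transform g : measurable_fun setT g ->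
  measurable_fun setT (cos_transform g).
Proof.
move=> mg.
apply: (measurable_Rintegral_param (@mu2 R)
  (f := fun z : plane * plane => g z.2 * cos (dotp z.2 z.1))).
apply: measurable_funM; first exact: (measurableT_comp mg measurable_snd).
exact: (measurableT_comp measurable_cos measurable_dotp).
Qed.

Lemma measurable_sin_transform g : measurable_fun setT g ->
  measurable_fun setT (sin_transform g).
Proof.
move=> mg.
apply: (measurable_Rintegral_param (@mu2 R)
  (f := fun z : plane * plane => g z.2 * sin (dotp z.2 z.1))).
apply: measurable_funM; first exact: (measurableT_comp mg measurable_snd).
exact: (measurableT_comp measurable_sin measurable_dotp).
Qed.

Lemma measurable_fsq g : measurable_fun setT g -> measurable_fun setT (fsq g).
Proof.
move=> mg; apply: measurable_funD; apply: measurable_funX.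
- exact: measurable_cos_transform.
- exact: measurable_sin_transform.
Qed.

Lemma fsq_ge0 g xi : 0 <= fsq g xi.
Proof. by rewrite addr_ge0// sqr_ge0. Qed.

(** Tiling in each variable folds the square onto one cell of area [w^2], where the integrand
    becomes a lattice sum bounded by [K]. *)
Lemma integral_square_tile_le (F : plane -> \bar R) (w K : R) (n : nat) :
  0 < w -> measurable_fun setT F -> (forall x, 0 <= F x)%E ->
  (forall xi : plane, \sum_(k : 'I_n * 'I_n)
     F (xi.1 + w *+ k.1, xi.2 + w *+ k.2)%R <= K%:E)%E ->
  forall a : R,
  (\int[mu2]_(x in `[a, (a + w *+ n)%R[ `*` `[a, (a + w *+ n)%R[) F x <=
   (K * w ^+ 2)%:E)%E.
Proof.
move=> w0 mF F0 FK a.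
have mI : measurable (`[a, (a + w *+ n)%R[%classic : set R) by exact: measurable_itv.
have mI0 : measurable (`[0%R, w[%classic : set R) by exact: measurable_itv.
rewrite /mu2 ge0_integral_setX//.
pose G (x y : measurableTypeR R) := (\sum_(j < n) F (x, y + (a + w *+ j))%R)%E.
have mFj (j : 'I_n) : measurable_fun setT
    (fun z : plane => F (z.1, z.2 + (a + w *+ j))%R).
  apply: (measurableT_comp mF); apply: measurable_fun_pair.
    exact: measurable_fst.
  by apply: measurable_funD => //; exact: measurable_snd.
have mG : measurable_fun setT (fun z : plane => G z.1 z.2).
  by apply: emeasurable_sum => j.
have G0 x y : (0 <= G x y)%E by apply: sume_ge0.
have w0' := ltW w0.
have step x : (\int[mu]_(y in `[a, (a + w *+ n)%R[) F (x, y) =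
               \int[mu]_(y in `[0%R, w[) G x y)%E.
  by rewrite ge0_integral_tile//; exact: measurable_fun_pair2.
under eq_integral do rewrite step.
have mH : measurable_fun setT (fun x => \int[mu]_(y in `[0%R, w[) G x y)%E.
  by apply: (measurable_ge0_integral_param mus mI0 mG) => z; exact: G0.
rewrite ge0_integral_tile//; last by move=> x; exact: integral_ge0.
have mGx x : measurable_fun setT (G x).
  exact: (measurable_fun_pair2 _ mG).
apply: (@le_trans _ _ (\int[mu]_(x in `[0%R, w[) (K * w)%:E)%E); last first.
  rewrite integral_cst//= lebesgue_measure_itv/= lte_fin w0 -EFinB subr0.
  by rewrite -EFinM expr2 mulrA.
apply: ge0_le_integral => //.
- by move=> x _; apply: sume_ge0 => i _; exact: integral_ge0.
- apply: measurable_funTS; apply: emeasurable_sum => i.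
  by apply: (measurableT_comp mH); exact: measurable_funD.
move=> x _; rewrite -ge0_integral_sum//; last first.
  by move=> i; apply: measurable_funTS; exact: mGx.
apply: (@le_trans _ _ (\int[mu]_(y in `[0%R, w[) K%:E)%E); last first.
  rewrite integral_cst//= lebesgue_measure_itv/= lte_fin w0 -EFinB subr0.
  by rewrite -EFinM.
apply: ge0_le_integral => //.
- by move=> y _; apply: sume_ge0.
- by apply: measurable_funTS; apply: emeasurable_sum => i; exact: mGx.
move=> y _; rewrite (le_trans _ (FK (x + a, y + a)%R))//.
rewrite pair_bigA/=; apply: lee_sum => k _ /=.
by rewrite !addrA.
Qed.

Lemma ge0_integral_le_squares (F : plane -> \bar R) (K : \bar R) :
  measurable_fun setT F -> (forall x, 0 <= F x)%E ->
  (forall n : nat, (\int[mu2]_(x in `[(- n%:R)%R, n%:R[ `*` `[(- n%:R)%R, n%:R[)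
     F x <= K)%E) ->
  (\int[mu2]_x F x <= K)%E.
Proof.
move=> mF F0 FK.
pose S n : set plane := `[(- n%:R)%R, n%:R[ `*` `[(- n%:R)%R, n%:R[.
have ST : \bigcup_n S n = setT.
  apply/seteqP; split => // -[x y] _.
  exists (Num.truncn (`|x| + `|y|)).+1 => //.
  have xy : `|x| + `|y| < (Num.truncn (`|x| + `|y|)).+1%:R by exact: truncnS_gt.
  have x0 := normr_ge0 x; have y0 := normr_ge0 y.
  have : `|x| < (Num.truncn (`|x| + `|y|)).+1%:R by lra.
  have : `|y| < (Num.truncn (`|x| + `|y|)).+1%:R by lra.
  rewrite !ltr_norml => /andP[? ?] /andP[? ?].
  by split; rewrite /= in_itv/=; apply/andP; split => //; exact: ltW.
have ndS : nondecreasing_seq S.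
  move=> m n mn; apply/subsetPset => -[x y] [/=].
  rewrite !in_itv/= => /andP[? ?] /andP[? ?].
  have mnR : m%:R <= n%:R :> R by rewrite ler_nat.
  by split; rewrite /= in_itv/=; apply/andP; split; lra.
rewrite -ST.
have mS n : measurable (S n) by apply: measurableX; exact: measurable_itv.
have mFS n : measurable_fun (S n) F by exact: measurable_funTS.
have FS0 n x : S n x -> (0 <= F x)%E by [].
have /cvg_lim <-// := @ge0_nondecreasing_set_cvg_integral _ _ R S F mu2 ndS mS mFS FS0.
apply: lime_le; last by apply: nearW => n; exact: FK.
apply: ereal_nondecreasing_is_cvgn.
exact: ge0_nondecreasing_set_nondecreasing_integral.
Qed.

Lemma plancherel_le g (L : R) : bmf g ->
  (forall x, ~ box L x -> g x = 0) ->
  (\int[mu2]_xi (fsq g xi)%:E <= ((2 * pi) ^+ 2)%:E * \int[mu2]_x (g x ^+ 2)%:E)%E.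
Proof.
move=> bg gL.
(* With an integer [N], the side [2 n] of a frequency square is a multiple of the spacing [1 / N];
   since [N > |L|] and [pi >= 2], the enlarged box still contains the support. *)
pose N := (Num.truncn `|L|).+1.
have N0 : 0 < N%:R :> R by rewrite ltr0n.
have g0 x : ~ box (pi * N%:R) x -> g x = 0.
  move=> xN; apply: gL => xL; apply: xN.
  have LN : L <= pi * N%:R.
    have := pi_ge2 R; have := ler_norm L; have := truncnS_gt `|L|; rewrite -/N.
    nra.
  by case: xL => /=; rewrite !in_itv/= => /andP[? ?] /andP[? ?];
    split; rewrite /= in_itv/=; apply/andP; split; lra.
pose J := \int[mu2]_(x in box (pi * N%:R)) (g x ^+ 2).
have p0 : 0 <= pi * N%:R :> R by rewrite mulr_ge0// pi_ge0.
have JE : (J%:E <= \int[mu2]_x (g x ^+ 2)%:E)%E.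
  rewrite /J /Rintegral fineK; last first.
    apply: integrable_fin_num; first exact: measurable_box.
    apply: bmf_integrable; [exact: measurable_box|exact: mu2_box_lty|].
    exact: bmfX.
  apply: ge0_subset_integral => //; first exact: measurable_box.
    by apply/measurable_EFinP; apply: measurable_funX; exact: bg.1.
  by move=> x _; rewrite lee_fin sqr_ge0.
apply: (@le_trans _ _ (((2 * pi) ^+ 2)%:E * J%:E)%E); last first.
  by apply: lee_wpmul2l => //; rewrite lee_fin sqr_ge0.
apply: ge0_integral_le_squares => //.
- by apply/measurable_EFinP; apply: measurable_fsq; exact: bg.1.
- by move=> x; rewrite lee_fin fsq_ge0.
move=> n.
have := @integral_square_tile_le (fun x => (fsq g x)%:E) N%:R^-1
  ((2 * (pi * N%:R)) ^+ 2 * J) (2 * n * N) _ _ _ _ (- n%:R).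
have -> : - n%:R + N%:R^-1 *+ (2 * n * N) = n%:R :> R.
  by rewrite -[_ *+ (_ * N)]mulr_natr !natrM; field; rewrite gt_eqF.
(* The area of the box and the area of the frequency cell compensate, so the constant does not see
   the size of the support. *)
have -> : (2 * (pi * N%:R)) ^+ 2 * J * N%:R^-1 ^+ 2 = (2 * pi) ^+ 2 * J.
  by field; rewrite gt_eqF.
rewrite EFinM; apply.
- by rewrite invr_gt0.
- by apply/measurable_EFinP; apply: measurable_fsq; exact: bg.1.
- by move=> x; rewrite lee_fin fsq_ge0.
move=> xi; rewrite sumEFin lee_fin.
rewrite (eq_bigr (fun k : 'I_(2 * n * N) * 'I_(2 * n * N) =>
    fsq g (xi.1 + k.1%:R / N%:R, xi.2 + k.2%:R / N%:R))).
  exact: fsq_lattice_le.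
by move=> k _; rewrite !mulr_natl.
Qed.

End Plancherel.

(** * Weighted estimates of the transform *)

Section WeightedFourier.
Context {R : realType}.
Local Notation plane := (plane (R := R)).
Implicit Types (g V psi : plane -> R) (xi : plane).

Lemma integrable_mul_cos g xi : mu2.-integrable setT (EFin \o g) ->
  mu2.-integrable setT (EFin \o (fun x => g x * cos (dotp x xi))).
Proof.
move=> ig.
have mg : measurable_fun setT g.
  by apply/measurable_EFinP; exact: measurable_int ig.
have bc := bmf_cos_dotp xi 0.
have mc : measurable_fun setT (fun x => cos (dotp x xi)).
  by move: bc.1; under eq_fun do rewrite addr0.
apply: le_integrable ig => //.
  by apply/measurable_EFinP; exact: measurable_funM.
move=> x _ /=; rewrite lee_fin normrM ler_piMr//.
by rewrite ler_norml cos_geN1 cos_le1.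
Qed.

Lemma integrable_mul_sin g xi : mu2.-integrable setT (EFin \o g) ->
  mu2.-integrable setT (EFin \o (fun x => g x * sin (dotp x xi))).
Proof.
move=> ig.
have mg : measurable_fun setT g.
  by apply/measurable_EFinP; exact: measurable_int ig.
have bc := bmf_sin_dotp xi 0.
have mc : measurable_fun setT (fun x => sin (dotp x xi)).
  by move: bc.1; under eq_fun do rewrite addr0.
apply: le_integrable ig => //.
  by apply/measurable_EFinP; exact: measurable_funM.
move=> x _ /=; rewrite lee_fin normrM ler_piMr//.
by rewrite ler_norml sin_geN1 sin_le1.
Qed.

Lemma fsqD_le g1 g2 xi : mu2.-integrable setT (EFin \o g1) ->
  mu2.-integrable setT (EFin \o g2) ->
  fsq (fun x => g1 x + g2 x) xi <= 2 * fsq g1 xi + 2 * fsq g2 xi.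
Proof.
move=> i1 i2; rewrite /fsq /cos_transform /sin_transform.
under eq_Rintegral do rewrite mulrDl.
rewrite RintegralD//; [|exact: integrable_mul_cos..].
under [X in _ + X ^+ 2 <= _]eq_Rintegral do rewrite mulrDl.
rewrite RintegralD//; [|exact: integrable_mul_sin..].
set a := Rintegral _ _ _; set b := Rintegral _ _ _.
set c := Rintegral _ _ _; set d := Rintegral _ _ _.
have := sqr_ge0 (a - b); have := sqr_ge0 (c - d); nra.
Qed.

Lemma fsq_le_L1 g xi (B : R) : mu2.-integrable setT (EFin \o g) ->
  (\int[mu2]_x `|g x|%:E <= B%:E)%E -> fsq g xi <= 2 * B ^+ 2.
Proof.
move=> ig gB.
have B0 : 0 <= B by rewrite -lee_fin (le_trans _ gB)// integral_ge0.
have sqB (z : R) : `|z| <= B -> z ^+ 2 <= B ^+ 2.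
  by rewrite ler_norml => /andP[? ?]; nra.
have le h : (forall x : plane, `|h x| <= 1) ->
    mu2.-integrable setT (EFin \o (fun x => g x * h x)) ->
    `|\int[mu2]_x (g x * h x)| <= B.
  move=> h1 igh; rewrite -lee_fin EFin_normr_Rintegral//.
  apply: le_trans (le_abse_integral _ _ _) _ => //; first exact: measurable_int igh.
  apply: le_trans gB; apply: ge0_le_integral => //.
  - by apply: measurableT_comp => //; exact: measurable_int igh.
  - by apply/measurable_EFinP; apply: measurableT_comp => //;
      apply/measurable_EFinP; exact: measurable_int ig.
  - by move=> x _; rewrite lee_fin normrM ler_piMr.
rewrite mulr_natl mulr2n; apply: lerD; apply: sqB; apply: le.
- by move=> x; rewrite ler_norml cos_geN1 cos_le1.
- exact: integrable_mul_cos.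
- by move=> x; rewrite ler_norml sin_geN1 sin_le1.
- exact: integrable_mul_sin.
Qed.

(** In [v = v^(1 - m) v^m] the first factor has a nonpositive exponent, so it is largest at the
    threshold [lam]. *)
Lemma le_powR_above (m lam v : R) : 1 <= m -> 0 < lam -> lam < v ->
  v <= lam `^ (1 - m) * v `^ m.
Proof.
move=> m1 lam0 lv; have v0 : 0 < v by lra.
rewrite -[1 - m]opprB powRN ler_pdivlMl ?powR_gt0//.
have -> : v `^ m = v `^ (m - 1) * v.
  rewrite -[X in _ = _ * X](powRr1 (ltW v0)) -powRD ?addrNK//.
  by apply/implyP => _; rewrite gt_eqF.
by rewrite ler_pM2r// ge0_ler_powR ?nnegrE//; lra.
Qed.

(** In [v^2 = v^(2 - m) v^m] the first factor has a nonnegative exponent and is bounded by its value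
    at [lam]. *)
Lemma sqr_le_powR_below (m lam v : R) : 1 <= m -> m <= 2 -> 0 <= v ->
  v <= lam -> v ^+ 2 <= lam `^ (2 - m) * v `^ m.
Proof.
move=> m1 m2 v0 vl; have [->|vn0] := eqVneq v 0.
  by rewrite expr0n/= mulr_ge0// powR_ge0.
have -> : v ^+ 2 = v `^ (2 - m) * v `^ m.
  rewrite -powRD ?subrK ?powR_mulrn//.
  by apply/implyP => _.
by rewrite ler_wpM2r ?powR_ge0// ge0_ler_powR ?nnegrE//; lra.
Qed.

(** The cut is made on a majorant [V], later the norm of the whole untruncated vector, so that [A]
    is common to all components and truncations. The support radius [L] is absent from the bound. In
    the constant 4, one factor 2 comes from splitting [g] and one from [fsq_le_L1]. *)
Lemma weighted_fsq_le g V psi (m lam L A P1 Pinf : R) :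
  1 <= m -> m <= 2 -> 0 < lam ->
  measurable_fun setT g -> measurable_fun setT V -> measurable_fun setT psi ->
  (forall x, `|g x| <= V x) -> (forall x, ~ box L x -> g x = 0) ->
  (\int[mu2]_x (V x `^ m)%:E <= A%:E)%E ->
  (forall x, 0 <= psi x) -> (forall x, psi x <= Pinf) ->
  (\int[mu2]_x (psi x)%:E <= P1%:E)%E ->
  (\int[mu2]_xi (psi xi * fsq g xi)%:E <=
   (4 * P1 * (lam `^ (1 - m) * A) ^+ 2 +
    2 * Pinf * (2 * pi) ^+ 2 * (lam `^ (2 - m) * A))%:E)%E.
Proof.
move=> m1 m2 lam0 mg mV mpsi gV gL VA psi0 psiP psi1.
pose g1 x := if lam < V x then g x else 0.
pose g2 x := if lam < V x then 0 else g x.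
have V0 x : 0 <= V x by exact: le_trans (gV x).
have mb : measurable_fun setT (fun x => lam < V x) by exact: measurable_fun_ltr.
have mg1 : measurable_fun setT g1 by exact: measurable_fun_ifT.
have mg2 : measurable_fun setT g2 by exact: measurable_fun_ifT.
have mVm : measurable_fun setT (fun x => V x `^ m).
  exact: (measurableT_comp (measurable_powR m) mV).
have iVm : mu2.-integrable setT (fun x => (V x `^ m)%:E).
  apply/integrableP; split; first exact/measurable_EFinP.
  under eq_integral do rewrite gee0_abs ?lee_fin ?powR_ge0//.
  by apply: le_lt_trans VA _; rewrite ltry.
have g1V x : `|g1 x| <= lam `^ (1 - m) * V x `^ m.
  rewrite /g1; case: ifPn => [lV|_]; last first.
    by rewrite normr0 mulr_ge0// powR_ge0.
  by apply: le_trans (gV x) _; exact: le_powR_above.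
have ig1 : mu2.-integrable setT (EFin \o g1).
  apply: (le_integrable _ _ _ (integrableZl _ (lam `^ (1 - m)) iVm)) => //.
    exact/measurable_EFinP.
  move=> x _ /=; rewrite lee_fin (le_trans (g1V x))// ler_norm.
  by [].
have g1A : (\int[mu2]_x `|g1 x|%:E <= (lam `^ (1 - m) * A)%:E)%E.
  apply: (@le_trans _ _ (\int[mu2]_x ((lam `^ (1 - m))%:E * (V x `^ m)%:E))%E).
    apply: ge0_le_integral => //.
    - by apply/measurable_EFinP; exact: measurableT_comp.
    - by apply/measurable_EFinP; exact: measurable_funM.
    - by move=> x _; rewrite -EFinM lee_fin.
  rewrite ge0_integralZl//; [|exact/measurable_EFinP| |].
  - by rewrite EFinM lee_wpmul2l// lee_fin powR_ge0.
  - by move=> x _; rewrite lee_fin powR_ge0.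
  - by rewrite lee_fin powR_ge0.
have g2lam x : `|g2 x| <= lam.
  rewrite /g2; case: ifPn => [_|]; first by rewrite normr0 ltW.
  by rewrite -leNgt; exact: le_trans.
have bg2 : bmf g2 by split => //; exists lam.
have g2L x : ~ box L x -> g2 x = 0 by move=> /gL; rewrite /g2 => ->; case: ifP.
have g2V x : g2 x ^+ 2 <= lam `^ (2 - m) * V x `^ m.
  rewrite /g2; case: ifPn => [_|].
    by rewrite expr0n/= mulr_ge0// powR_ge0.
  rewrite -leNgt => Vl; apply: le_trans (sqr_le_powR_below m1 m2 (V0 x) Vl).
  by have := gV x; rewrite ler_norml => /andP[? ?]; nra.
have g2A : (\int[mu2]_x (g2 x ^+ 2)%:E <= (lam `^ (2 - m) * A)%:E)%E.
  apply: (@le_trans _ _ (\int[mu2]_x ((lam `^ (2 - m))%:E * (V x `^ m)%:E))%E).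
    apply: ge0_le_integral => //.
    - by move=> x _; rewrite lee_fin sqr_ge0.
    - by apply/measurable_EFinP; exact: measurable_funX.
    - by apply/measurable_EFinP; exact: measurable_funM.
    - by move=> x _; rewrite lee_fin.
  rewrite ge0_integralZl//; [|exact/measurable_EFinP| |].
  - by rewrite EFinM lee_wpmul2l// lee_fin powR_ge0.
  - by move=> x _; rewrite lee_fin powR_ge0.
  - by rewrite lee_fin powR_ge0.
have ig2 : mu2.-integrable setT (EFin \o g2).
  (* [L] may be negative, whereas the measure of a box is computed for a nonnegative half-side. *)
  have iB : mu2.-integrable setT ((EFin \o g2) \_ (box `|L|)).
    apply: (integrable_mkcond _ (measurable_box _)).1.
    by apply: bmf_integrable => //; [exact: measurable_box|exact: mu2_box_lty].
  apply: eq_integrable iB => // x _; rewrite patchE; case: ifPn => //.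
  move=> /negP; rewrite inE => bx; rewrite /= g2L// => bL; apply: bx.
  have := ler_norm L; case: bL => /=; rewrite !in_itv/= => /andP[? ?] /andP[? ?] ?.
  by split; rewrite /= in_itv/=; apply/andP; split; lra.
have gE : g = (fun x => g1 x + g2 x).
  by apply/funext => x; rewrite /g1 /g2; case: ifP; rewrite ?addr0 ?add0r.
have Pinf0 : 0 <= Pinf by exact: le_trans (psi0 (0, 0)) (psiP _).
have pw xi : psi xi * fsq g xi <= 4 * (lam `^ (1 - m) * A) ^+ 2 * psi xi
    + 2 * Pinf * fsq g2 xi.
  have h1 : psi xi * fsq g xi <= psi xi * (2 * fsq g1 xi + 2 * fsq g2 xi).
    by rewrite ler_wpM2l// {1}gE fsqD_le.
  have h2 : psi xi * fsq g1 xi <= psi xi * (2 * (lam `^ (1 - m) * A) ^+ 2).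
    by rewrite ler_wpM2l// fsq_le_L1.
  have h3 : psi xi * fsq g2 xi <= Pinf * fsq g2 xi.
    by rewrite ler_wpM2r// fsq_ge0.
  lra.
have mf2 := measurable_fsq mg2.
apply: (@le_trans _ _ (\int[mu2]_xi
   ((4 * (lam `^ (1 - m) * A) ^+ 2)%:E * (psi xi)%:E
    + (2 * Pinf)%:E * (fsq g2 xi)%:E))%E).
  apply: ge0_le_integral => //.
  - by move=> x _; rewrite lee_fin mulr_ge0// fsq_ge0.
  - by apply/measurable_EFinP; apply: measurable_funM => //; exact: measurable_fsq.
  - by apply/measurable_EFinP; apply: measurable_funD; exact: measurable_funM.
  - by move=> x _; rewrite -!EFinM -EFinD lee_fin.
have c1 : 0 <= 4 * (lam `^ (1 - m) * A) ^+ 2 by rewrite mulr_ge0// sqr_ge0.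
have c2 : 0 <= 2 * Pinf by rewrite mulr_ge0.
rewrite ge0_integralD//; last 4 first.
- by move=> x _; rewrite -EFinM lee_fin mulr_ge0.
- by apply/measurable_EFinP; exact: measurable_funM.
- by move=> x _; rewrite -EFinM lee_fin mulr_ge0// fsq_ge0.
- by apply/measurable_EFinP; exact: measurable_funM.
rewrite !ge0_integralZl//; last 4 first.
- exact/measurable_EFinP.
- by move=> x _; rewrite lee_fin fsq_ge0.
- exact/measurable_EFinP.
- by move=> x _; rewrite lee_fin.
rewrite EFinD; apply: leeD.
  rewrite (_ : 4 * P1 * _ = 4 * (lam `^ (1 - m) * A) ^+ 2 * P1); last by ring.
  by rewrite [leRHS]EFinM lee_wpmul2l.
rewrite -mulrA [leRHS]EFinM lee_wpmul2l//.
apply: le_trans (plancherel_le bg2 g2L) _.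
by rewrite [leRHS]EFinM lee_wpmul2l// lee_fin sqr_ge0.
Qed.

End WeightedFourier.

(** * Reduction of vector-valued transforms to real scalar functions *)

Section VectorValued.
Context {R : realType}.
Local Notation plane := (plane (R := R)).
Local Notation vec4 := (vec4 (R := R)).
Implicit Types (u w : plane -> vec4) (v : vec4) (psi : plane -> R).

Definition vsq v : R := \sum_j (complex.Re (v j 0) ^+ 2 + complex.Im (v j 0) ^+ 2).

Lemma vsq_ge0 v : 0 <= vsq v.
Proof. by apply: sumr_ge0 => j _; rewrite addr_ge0// sqr_ge0. Qed.

Lemma vsq0 : vsq 0 = 0.
Proof. by rewrite /vsq big1// => j _; rewrite mxE/= expr0n addr0. Qed.

Lemma sqr_vnorm v : vnorm v ^+ 2 = vsq v.
Proof. by rewrite sqr_sqrtr// vsq_ge0. Qed.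

Lemma vnorm_ge0 v : 0 <= vnorm v.
Proof. exact: sqrtr_ge0. Qed.

Lemma ReD (x y : R[i]) : complex.Re (x + y) = complex.Re x + complex.Re y.
Proof. by case: x y => [a b] []. Qed.

Lemma ImD (x y : R[i]) : complex.Im (x + y) = complex.Im x + complex.Im y.
Proof. by case: x y => [a b] []. Qed.

Lemma ReN (x : R[i]) : complex.Re (- x) = - complex.Re x.
Proof. by case: x. Qed.

Lemma ImN (x : R[i]) : complex.Im (- x) = - complex.Im x.
Proof. by case: x. Qed.

Lemma ReM (x y : R[i]) :
  complex.Re (x * y) = complex.Re x * complex.Re y - complex.Im x * complex.Im y.
Proof. by case: x y => [a b] []. Qed.

Lemma ImM (x y : R[i]) :
  complex.Im (x * y) = complex.Re x * complex.Im y + complex.Im x * complex.Re y.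
Proof. by case: x y => [a b] []. Qed.

Lemma normr_Re_le v j : `|complex.Re (v j 0)| <= vnorm v.
Proof.
rewrite -sqrtr_sqr ler_sqrt; last exact: vsq_ge0.
rewrite (bigD1 j)//= -addrA lerDl addr_ge0 ?sqr_ge0//.
by apply: sumr_ge0 => k _; rewrite addr_ge0// sqr_ge0.
Qed.

Lemma normr_Im_le v j : `|complex.Im (v j 0)| <= vnorm v.
Proof.
rewrite -sqrtr_sqr ler_sqrt; last exact: vsq_ge0.
rewrite (bigD1 j)//= addrAC lerDr addr_ge0 ?sqr_ge0//.
by apply: sumr_ge0 => k _; rewrite addr_ge0// sqr_ge0.
Qed.

Lemma vsqD_le v v' : vsq (v + v') <= 2 * vsq v + 2 * vsq v'.
Proof.
rewrite /vsq !mulr_sumr -big_split; apply: ler_sum => j _ /=.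
rewrite !mxE ReD ImD.
set a := complex.Re _; set b := complex.Re _.
set c := complex.Im _; set d := complex.Im _.
have := sqr_ge0 (a - b); have := sqr_ge0 (c - d); nra.
Qed.

Lemma vsqN v : vsq (- v) = vsq v.
Proof. by apply: eq_bigr => j _; rewrite !mxE ReN ImN !sqrrN. Qed.

Lemma vsqZ (r : R) v : vsq (real_complex R r *: v) = r ^+ 2 * vsq v.
Proof.
rewrite /vsq mulr_sumr; apply: eq_bigr => j _; rewrite !mxE ReM ImM/=.
by rewrite !mul0r subr0 addr0 mulrDr !exprMn.
Qed.

Lemma measurable_vsq u : vmeasurable u -> measurable_fun setT (fun x => vsq (u x)).
Proof.
move=> mu; apply: measurable_sum => j; have [m1 m2] := mu j.
by apply: measurable_funD; exact: measurable_funX.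
Qed.

Lemma measurable_sqrt : measurable_fun setT (@Num.sqrt R).
Proof. by apply: continuous_measurable_fun; exact: sqrt_continuous. Qed.

Lemma measurable_vnorm u : vmeasurable u ->
  measurable_fun setT (fun x => vnorm (u x)).
Proof. by move=> mu; exact: (measurableT_comp measurable_sqrt (measurable_vsq mu)). Qed.

Lemma measurable_enorm : measurable_fun setT (@enorm R).
Proof.
apply: (measurableT_comp measurable_sqrt).
apply: measurable_funD; apply: measurable_funM.
- exact: measurable_fst.
- exact: measurable_fst.
- exact: measurable_snd.
- exact: measurable_snd.
Qed.

Lemma vmeasurableD u w : vmeasurable u -> vmeasurable w ->
  vmeasurable (fun x => u x + w x).
Proof.
move=> mu mw j; have [m1 m2] := mu j; have [m3 m4] := mw j; split.
- by under eq_fun do rewrite !mxE ReD; exact: measurable_funD.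
- by under eq_fun do rewrite !mxE ImD; exact: measurable_funD.
Qed.

Lemma vmeasurableN u : vmeasurable u -> vmeasurable (fun x => - u x).
Proof.
move=> mu j; have [m1 m2] := mu j; split.
- by under eq_fun do rewrite !mxE ReN; exact: measurable_funN.
- by under eq_fun do rewrite !mxE ImN; exact: measurable_funN.
Qed.

Lemma vmeasurable_truncate n u : vmeasurable u -> vmeasurable (truncate n u).
Proof.
move=> mu j; have [m1 m2] := mu j.
have mb : measurable_fun setT (fun x => @enorm R x <= n%:R).
  by apply: measurable_fun_ler => //; exact: measurable_enorm.
split.
- rewrite (_ : (fun x => _) =
      (fun x => if enorm x <= n%:R then complex.Re (u x j 0) else 0)).
    exact: measurable_fun_ifT.
  by apply/funext => x; rewrite /truncate; case: ifP; rewrite // mxE.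
- rewrite (_ : (fun x => _) =
      (fun x => if enorm x <= n%:R then complex.Im (u x j 0) else 0)).
    exact: measurable_fun_ifT.
  by apply/funext => x; rewrite /truncate; case: ifP; rewrite // mxE.
Qed.

Lemma truncate_box n u x : ~ box n%:R x -> truncate n u x = 0.
Proof.
rewrite /truncate; case: ifPn => // xn bx; exfalso; apply: bx.
have le (a : R) : a ^+ 2 <= dotp x x -> `|a| <= n%:R.
  by move=> ax; apply: le_trans xn; rewrite -sqrtr_sqr ler_wsqrtr.
rewrite /box; split; rewrite /= in_itv/= -ler_norml; apply: le;
  by rewrite /dotp -!expr2 ?lerDl ?lerDr sqr_ge0.
Qed.

Lemma vnorm_truncate_le n u x : vnorm (truncate n u x) <= vnorm (u x).
Proof.
rewrite /truncate; case: ifPn => // _.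
by rewrite /vnorm -/(vsq 0) vsq0 sqrtr0 sqrtr_ge0.
Qed.

Lemma Lnorm4E (p : R) u : Lnorm4 p u =
  ((\int[mu2]_x (vnorm (u x) `^ p)%:E) `^ p^-1)%E.
Proof.
rewrite /Lnorm4 unlock; congr (_ `^ _)%E; apply: eq_integral => x _.
by rewrite /= ger0_norm ?vnorm_ge0.
Qed.

Lemma Lnorm4_2E u : Lnorm4 2 u = ((\int[mu2]_x (vsq (u x))%:E) `^ 2^-1)%E.
Proof.
rewrite Lnorm4E; congr (_ `^ _)%E; apply: eq_integral => x _.
by rewrite powR_mulrn ?vnorm_ge0// sqr_vnorm.
Qed.

Lemma inL2_integrable u : inL 2 u ->
  (\int[mu2]_x (vsq (u x))%:E < +oo)%E.
Proof.
move=> [mu]; rewrite Lnorm4_2E; set I := integral _ _ _.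
have I0 : (0 <= I)%E by apply: integral_ge0 => x _; rewrite lee_fin vsq_ge0.
by case: I I0 => [r _|/=|]//=; rewrite ?ltry// invr_eq0 pnatr_eq0.
Qed.

(** On a bounded set [L^2] embeds in [L^1]: the majorant is the indicator of a box plus [|u|^2],
    through [v <= 1 + v^2]. [h] stands for the real or imaginary part of a coordinate. *)
Lemma integrable_truncate n u (h : vec4 -> R) : inL 2 u ->
  (forall v, `|h v| <= vnorm v) ->
  measurable_fun setT (fun x => h (truncate n u x)) ->
  mu2.-integrable setT (fun x => (h (truncate n u x))%:E).
Proof.
move=> uL2 hv mh; have mu := uL2.1.
have mvu := measurable_vsq mu.
have i1 : mu2.-integrable setT ((EFin \o cst (1 : R)) \_ (box n%:R)).
  apply: (integrable_mkcond _ (measurable_box _)).1.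
  apply: bmf_integrable; [exact: measurable_box|exact: mu2_box_lty|].
  exact: bmf_cst.
have i2 : mu2.-integrable setT (fun x => (vsq (u x))%:E).
  apply/integrableP; split; first exact/measurable_EFinP.
  under eq_integral do rewrite gee0_abs ?lee_fin ?vsq_ge0//.
  exact: inL2_integrable.
apply: (le_integrable _ _ _ (integrableD _ i1 i2)) => //.
  exact/measurable_EFinP.
move=> x _ /=; rewrite patchE; case: ifPn => [|/negP]; rewrite inE => bx.
  rewrite -EFinD lee_fin (le_trans (hv _))// (le_trans (vnorm_truncate_le _ _ _))//.
  rewrite ger0_norm ?addr_ge0 ?vsq_ge0// -sqr_vnorm.
  by have := vnorm_ge0 (u x); rewrite /cst; nra.
rewrite add0e /= lee_fin (le_trans (hv _))// truncate_box//.
by rewrite /vnorm -/(vsq 0) vsq0 sqrtr0 normr_ge0.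
Qed.

Lemma Re_fourierL1 u xi j :
  mu2.-integrable setT (fun x => (complex.Re (u x j 0))%:E) ->
  mu2.-integrable setT (fun x => (complex.Im (u x j 0))%:E) ->
  complex.Re (fourierL1 u xi j 0) = (2 * pi)^-1 *
    (cos_transform (fun x => complex.Re (u x j 0)) xi +
     sin_transform (fun x => complex.Im (u x j 0)) xi).
Proof.
move=> i1 i2; rewrite /fourierL1 mxE ReM/= mul0r subr0; congr (_ * _).
rewrite /cos_transform /sin_transform -RintegralD//; last 2 first.
- exact: (integrable_mul_cos _ i1).
- exact: (integrable_mul_sin _ i2).
apply: eq_Rintegral => x _; rewrite ReM/=; ring.
Qed.

Lemma Im_fourierL1 u xi j :
  mu2.-integrable setT (fun x => (complex.Re (u x j 0))%:E) ->
  mu2.-integrable setT (fun x => (complex.Im (u x j 0))%:E) ->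
  complex.Im (fourierL1 u xi j 0) = (2 * pi)^-1 *
    (cos_transform (fun x => complex.Im (u x j 0)) xi -
     sin_transform (fun x => complex.Re (u x j 0)) xi).
Proof.
move=> i1 i2; rewrite /fourierL1 mxE ImM/= mul0r addr0; congr (_ * _).
rewrite /cos_transform /sin_transform -RintegralB//; last 2 first.
- exact: (integrable_mul_cos _ i2).
- exact: (integrable_mul_sin _ i1).
apply: eq_Rintegral => x _; rewrite ImM/=; ring.
Qed.

Section Truncated.
Context (u : plane -> vec4) (n : nat) (uL2 : inL 2 u).

Let iRe j : mu2.-integrable setT (fun x => (complex.Re (truncate n u x j 0))%:E).
Proof.
apply: (@integrable_truncate n u (fun v => complex.Re (v j 0))) => //.
- by move=> v; exact: normr_Re_le.
- exact: (vmeasurable_truncate n uL2.1 j).1.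
Qed.

Let iIm j : mu2.-integrable setT (fun x => (complex.Im (truncate n u x j 0))%:E).
Proof.
apply: (@integrable_truncate n u (fun v => complex.Im (v j 0))) => //.
- by move=> v; exact: normr_Im_le.
- exact: (vmeasurable_truncate n uL2.1 j).2.
Qed.

Lemma vmeasurable_fourier_truncate : vmeasurable (fourierL1 (truncate n u)).
Proof.
move=> j; have [m1 m2] := vmeasurable_truncate n uL2.1 j; split.
- under eq_fun do rewrite Re_fourierL1//.
  apply: measurable_funM => //; apply: measurable_funD.
  + exact: measurable_cos_transform.
  + exact: measurable_sin_transform.
- under eq_fun do rewrite Im_fourierL1//.
  apply: measurable_funM => //; apply: measurable_funB.
  + exact: measurable_cos_transform.
  + exact: measurable_sin_transform.
Qed.

(** The transforms of the real and imaginary parts mix, and the mixed terms are absorbed by the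
    factor 2. The normalisation [(2 pi)^-1] is estimated by 1. *)
Lemma vsq_fourier_truncate_le xi : vsq (fourierL1 (truncate n u) xi) <=
  2 * \sum_j (fsq (fun x => complex.Re (truncate n u x j 0)) xi +
              fsq (fun x => complex.Im (truncate n u x j 0)) xi).
Proof.
rewrite /vsq mulr_sumr; apply: ler_sum => j _.
rewrite Re_fourierL1// Im_fourierL1// !exprMn -mulrDr.
rewrite /fsq.
set a := cos_transform _ _; set b := sin_transform _ _.
set c := cos_transform _ _; set d := sin_transform _ _.
have : (2 * pi)^-1 ^+ 2 <= 1 :> R.
  rewrite expr_le1// ?invr_ge0 ?mulr_ge0 ?pi_ge0// invf_le1 ?mulr_gt0 ?pi_gt0//.
  by have := pi_ge2 R; lra.
move=> r1; apply: (@le_trans _ _ ((a + b) ^+ 2 + (c - d) ^+ 2)).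
  by rewrite ler_piMl// addr_ge0// sqr_ge0.
have := sqr_ge0 (a - b); have := sqr_ge0 (c + d); nra.
Qed.

End Truncated.

End VectorValued.

(** * Passage from truncations to the Plancherel transform *)

Section L2Limit.
Context {R : realType}.
Local Notation plane := (plane (R := R)).
Local Notation vec4 := (vec4 (R := R)).
Implicit Types (u w : plane -> vec4) (psi : plane -> R).

Lemma is_fourier_approx u w (e : R) : is_fourier u w -> 0 < e ->
  \forall n \near \oo,
    (\int[mu2]_xi (vsq (fourierL1 (truncate n u) xi - w xi)%R)%:E <= e%:E)%E.
Proof.
move=> [uL2 mw cw] e0.
have e2 : 0 < Num.sqrt e by rewrite sqrtr_gt0.
have : \forall n \near \oo,
    (Lnorm4 2 (fun xi => fourierL1 (truncate n u) xi - w xi)%R < (Num.sqrt e)%:E)%E.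
  apply: (cw [set x | (x < (Num.sqrt e)%:E)%E]).
  by apply: open_nbhs_nbhs; split; [exact: open_ereal_lt_ereal|rewrite /= lte_fin].
apply: filterS => n; rewrite Lnorm4_2E => h.
set I := integral _ _ _ in h *.
have I0 : (0 <= I)%E by apply: integral_ge0 => x _; rewrite lee_fin vsq_ge0.
rewrite -(sqr_sqrtr (ltW e0)).
case: I I0 h => [r| |]//=; rewrite ?lee_fin ?lte_fin.
- move=> r0 h; rewrite -(sqr_sqrtr r0) lerXn2r ?nnegrE ?sqrtr_ge0//.
  by rewrite -powR12_sqrt// ltW.
- by rewrite invr_eq0 pnatr_eq0.
Qed.

(** The 16 is the factor 2 of [vsq_fourier_truncate_le] times four components with two real parts
    each. *)
Lemma integral_fourier_truncate_le u n psi (K : R) : inL 2 u ->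
  measurable_fun setT psi -> (forall x, 0 <= psi x) ->
  (forall j, \int[mu2]_xi (psi xi *
     fsq (fun x => complex.Re (truncate n u x j 0)) xi)%:E <= K%:E)%E ->
  (forall j, \int[mu2]_xi (psi xi *
     fsq (fun x => complex.Im (truncate n u x j 0)) xi)%:E <= K%:E)%E ->
  (\int[mu2]_xi (psi xi * vsq (fourierL1 (truncate n u) xi))%:E <=
   (16 * K)%:E)%E.
Proof.
move=> uL2 mpsi psi0 hRe hIm.
have mtr := vmeasurable_truncate n uL2.1.
pose FR j xi := (psi xi * fsq (fun x => complex.Re (truncate n u x j 0)) xi)%:E.
pose FI j xi := (psi xi * fsq (fun x => complex.Im (truncate n u x j 0)) xi)%:E.
have mFR j : measurable_fun setT (FR j).
  apply/measurable_EFinP; apply: measurable_funM => //.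
  by apply: measurable_fsq; exact: (mtr j).1.
have mFI j : measurable_fun setT (FI j).
  apply/measurable_EFinP; apply: measurable_funM => //.
  by apply: measurable_fsq; exact: (mtr j).2.
have FR0 j xi : (0 <= FR j xi)%E by rewrite lee_fin mulr_ge0// fsq_ge0.
have FI0 j xi : (0 <= FI j xi)%E by rewrite lee_fin mulr_ge0// fsq_ge0.
apply: (@le_trans _ _ (\int[mu2]_xi (2%:E * \sum_j (FR j xi + FI j xi)))%E).
  apply: ge0_le_integral => //.
  - by move=> x _; rewrite lee_fin mulr_ge0// vsq_ge0.
  - apply/measurable_EFinP; apply: measurable_funM => //.
    by apply: measurable_vsq; exact: vmeasurable_fourier_truncate.
  - apply: measurable_funeM; apply: emeasurable_sum => j.
    exact: emeasurable_funD.
  - move=> xi _.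
    under eq_bigr do rewrite /FR /FI -EFinD -mulrDr.
    rewrite sumEFin -EFinM lee_fin -mulr_sumr mulrCA ler_wpM2l//.
    exact: vsq_fourier_truncate_le.
rewrite ge0_integralZl//; last 2 first.
- by apply: emeasurable_sum => j; exact: emeasurable_funD.
- by move=> xi _; apply: sume_ge0 => j _; exact: adde_ge0.
rewrite ge0_integral_sum//; last 2 first.
- by move=> j; exact: emeasurable_funD.
- by move=> j xi _; exact: adde_ge0.
rewrite (_ : 16 * K = 2 * (\sum_(j < 4) (K + K))); last first.
  by rewrite !big_ord_recr big_ord0/=; ring.
rewrite EFinM lee_wpmul2l// -sumEFin; apply: lee_sum => j _.
by rewrite ge0_integralD// EFinD; apply: leeD; [exact: hRe|exact: hIm].
Qed.

(** The truncated bound is uniform in [n], and the boundedness of [psi] makes the weighted error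
    tend to 0. Comparing [w] with its approximation doubles the constant 16. *)
Lemma weighted_fourier_le u w psi (m lam A P1 Pinf : R) : is_fourier u w ->
  1 <= m -> m <= 2 -> 0 < lam ->
  (\int[mu2]_x (vnorm (u x) `^ m)%:E <= A%:E)%E ->
  measurable_fun setT psi ->
  (forall x, 0 <= psi x) -> (forall x, psi x <= Pinf) ->
  (\int[mu2]_x (psi x)%:E <= P1%:E)%E ->
  (\int[mu2]_xi (psi xi * vsq (w xi))%:E <=
   (32 * (4 * P1 * (lam `^ (1 - m) * A) ^+ 2 +
          2 * Pinf * (2 * pi) ^+ 2 * (lam `^ (2 - m) * A)))%:E)%E.
Proof.
move=> uw m1 m2 lam0 uA mpsi psi0 psiP psi1; have [uL2 mw _] := uw.
set K := (X in (32 * X)%:E).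
have Pinf0 : 0 <= Pinf by exact: le_trans (psi0 (0, 0)) (psiP _).
apply/lee_addgt0Pr => e e0.
(* The error enters below with the factor [2 (Pinf + 1)]; adding 1 avoids a zero denominator when
   [Pinf = 0]. *)
have e'0 : 0 < e / (2 * (Pinf + 1)) by apply: divr_gt0 => //; lra.
have [n _ /(_ n (leqnn n)) hn] := is_fourier_approx uw e'0.
have mF := vmeasurable_fourier_truncate n uL2.
have mD := vmeasurableD mF (vmeasurableN mw).
set F := fourierL1 (truncate n u) in hn mF mD *.
have mtr := vmeasurable_truncate n uL2.1.
have FK : (\int[mu2]_xi (psi xi * vsq (F xi))%:E <= (16 * K)%:E)%E.
  apply: integral_fourier_truncate_le => // j.
  - apply: (@weighted_fsq_le _ _ (fun x => vnorm (u x)) _ _ _ n%:R) => //.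
    + exact: (mtr j).1.
    + exact: (measurable_vnorm uL2.1).
    + by move=> x; apply: le_trans (vnorm_truncate_le n u x); exact: normr_Re_le.
    + by move=> x /truncate_box ->; rewrite mxE.
  - apply: (@weighted_fsq_le _ _ (fun x => vnorm (u x)) _ _ _ n%:R) => //.
    + exact: (mtr j).2.
    + exact: (measurable_vnorm uL2.1).
    + by move=> x; apply: le_trans (vnorm_truncate_le n u x); exact: normr_Im_le.
    + by move=> x /truncate_box ->; rewrite mxE.
apply: (@le_trans _ _ (\int[mu2]_xi (2%:E * (psi xi * vsq (F xi))%:E +
   (2 * (Pinf + 1))%:E * (vsq (F xi - w xi))%:E))%E).
  apply: ge0_le_integral => //.
  - by move=> x _; rewrite lee_fin mulr_ge0// vsq_ge0.
  - by apply/measurable_EFinP; apply: measurable_funM => //; exact: measurable_vsq.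
  - apply: emeasurable_funD; apply: measurable_funeM; apply/measurable_EFinP.
      by apply: measurable_funM => //; exact: measurable_vsq.
    exact: (measurable_vsq mD).
  - move=> xi _; rewrite -!EFinM -EFinD lee_fin.
    have h : vsq (w xi) <= 2 * vsq (F xi) + 2 * vsq (F xi - w xi).
      rewrite -[in leLHS](subKr (F xi) (w xi)) (le_trans (vsqD_le _ _))//.
      by rewrite vsqN.
    have := psi0 xi; have := psiP xi; have := vsq_ge0 (F xi - w xi).
    have := vsq_ge0 (F xi); have := vsq_ge0 (w xi); nra.
rewrite ge0_integralD//; last 4 first.
- by move=> x _; rewrite -EFinM lee_fin mulr_ge0// mulr_ge0// vsq_ge0.
- apply: measurable_funeM; apply/measurable_EFinP.
  by apply: measurable_funM => //; exact: measurable_vsq.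
- by move=> x _; rewrite -EFinM lee_fin mulr_ge0// ?vsq_ge0// mulr_ge0// addr_ge0.
- by apply: measurable_funeM; apply/measurable_EFinP; exact: (measurable_vsq mD).
rewrite !ge0_integralZl//; last 5 first.
- by apply/measurable_EFinP; exact: (measurable_vsq mD).
- by move=> x _; rewrite lee_fin vsq_ge0.
- by rewrite lee_fin mulr_ge0// addr_ge0.
- by apply/measurable_EFinP; apply: measurable_funM => //; exact: measurable_vsq.
- by move=> x _; rewrite lee_fin mulr_ge0// vsq_ge0.
rewrite [leRHS](_ : _ = (2%:E * (16 * K)%:E + (2 * (Pinf + 1))%:E *
    (e / (2 * (Pinf + 1)))%:E)%E); last first.
  by rewrite -!EFinM -!EFinD; congr EFin; field; rewrite gt_eqF//; lra.
apply: leeD; first exact: lee_wpmul2l.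
by apply: lee_wpmul2l => //; rewrite lee_fin mulr_ge0// addr_ge0.
Qed.

Lemma vsq_eq0 (v : vec4) : vsq v = 0 -> v = 0.
Proof.
move=> /eqP; rewrite psumr_eq0; last by move=> j _; rewrite addr_ge0// sqr_ge0.
move=> /allP v0; apply/matrixP => j k; rewrite ord1 mxE.
have /implyP/(_ isT) := v0 j (mem_index_enum j).
rewrite paddr_eq0 ?sqr_ge0// !sqrf_eq0 => /andP[/eqP a /eqP b].
by move: a b; case: (v j 0) => x y /= -> ->.
Qed.

(** Both functions are [L^2] limits of the same sequence. This links the transforms supplied by a
    solution to the representatives chosen in the norms. *)
Lemma is_fourier_unique u w w' : is_fourier u w -> is_fourier u w' ->
  {ae mu2, forall xi, w xi = w' xi}.
Proof.
move=> uw uw'; have [uL2 mw _] := uw; have [_ mw' _] := uw'.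
have mD := vmeasurableD mw (vmeasurableN mw').
suff I0 : (\int[mu2]_xi `|(vsq (w xi - w' xi))%:E| = 0)%E.
  have mV : measurable_fun setT (fun xi => (vsq (w xi - w' xi))%:E).
    by apply/measurable_EFinP; exact: (measurable_vsq mD).
  have := (ae_eq_integral_abs mu2 measurableT mV).1 I0.
  apply: filterS => xi /(_ I) [] /vsq_eq0 /eqP; rewrite subr_eq0 => /eqP.
  by [].
apply/eqP; rewrite eq_le integral_ge0// andbT.
apply/lee_addgt0Pr => e e0; rewrite add0e.
have e4 : 0 < e / 4 by rewrite divr_gt0.
have [n _ /(_ n (leqnn n))[h1 h2]] :=
  filterI (is_fourier_approx uw e4) (is_fourier_approx uw' e4).
have mF := vmeasurable_fourier_truncate n uL2.
have m1 := vmeasurableD mF (vmeasurableN mw).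
have m2 := vmeasurableD mF (vmeasurableN mw').
set F := fourierL1 (truncate n u) in h1 h2 mF m1 m2.
apply: (@le_trans _ _ (\int[mu2]_xi (2%:E * (vsq (F xi - w xi)%R)%:E +
   2%:E * (vsq (F xi - w' xi)%R)%:E))%E).
  apply: ge0_le_integral => //.
  - by apply/measurable_EFinP; apply: measurableT_comp => //; exact: (measurable_vsq mD).
  - apply: emeasurable_funD; apply: measurable_funeM; apply/measurable_EFinP.
      exact: (measurable_vsq m1).
    exact: (measurable_vsq m2).
  - move=> xi _; rewrite -!EFinM -EFinD lee_fin ger0_norm ?vsq_ge0//.
    rewrite (_ : w xi - w' xi = - (F xi - w xi) + (F xi - w' xi)).
      by rewrite (le_trans (vsqD_le _ _))// vsqN.
    by rewrite opprB addrA subrK.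
rewrite ge0_integralD//; last 4 first.
- by move=> x _; rewrite -EFinM lee_fin mulr_ge0// vsq_ge0.
- by apply: measurable_funeM; apply/measurable_EFinP; exact: (measurable_vsq m1).
- by move=> x _; rewrite -EFinM lee_fin mulr_ge0// vsq_ge0.
- by apply: measurable_funeM; apply/measurable_EFinP; exact: (measurable_vsq m2).
rewrite !ge0_integralZl//; last 4 first.
- by apply/measurable_EFinP; exact: (measurable_vsq m2).
- by move=> x _; rewrite lee_fin vsq_ge0.
- by apply/measurable_EFinP; exact: (measurable_vsq m1).
- by move=> x _; rewrite lee_fin vsq_ge0.
rewrite [leRHS](_ : _ = (2%:E * (e / 4)%:E + 2%:E * (e / 4)%:E)%E).
  by apply: leeD; apply: lee_wpmul2l.
by rewrite -!EFinM -EFinD; congr EFin; field.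
Qed.

End L2Limit.

(** * Decay of the ordinary differential system *)

Section Decay.
Context {R : realType}.
Implicit Types (h r t : R).

(** Multiply by [A] and complete the square; if [A = 0], the discriminant condition forces
    [C = 0]. *)
Lemma quadratic_form_ge0 (A B C x y : R) : 0 <= A -> 0 <= B ->
  C ^+ 2 <= 4 * A * B -> 0 <= A * x ^+ 2 + B * y ^+ 2 + C * x * y.
Proof.
move=> A0 B0 CAB; have [A00|An0] := eqVneq A 0.
  have -> : C = 0.
    by apply/eqP; rewrite -sqrf_eq0 eq_le sqr_ge0 andbT; move: CAB; rewrite A00; lra.
  by rewrite A00 !mul0r add0r addr0 mulr_ge0// sqr_ge0.
have Ap : 0 < A by rewrite lt_neqAle eq_sym An0.
rewrite -(pmulr_rge0 _ Ap).
have : 0 <= (A * x + C / 2 * y) ^+ 2 by exact: sqr_ge0.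
have : 0 <= (4 * A * B - C ^+ 2) * y ^+ 2 by rewrite mulr_ge0 ?sqr_ge0// subr_ge0.
lra.
Qed.

(* In p = px + i py, q = qx + i qy the equations are p' = -2hp + i beta q and
   q' = i beta p; in |p|^2 + |q|^2 + 2 k Re(i p conj(q)) the cross term
   transfers the damping of p to q. *)
Lemma dissipative_pair_decay (h beta k d : R) (px py qx qy : R -> R) :
  0 <= h -> 0 <= beta -> 0 <= k -> 8 * k <= 1 -> 4 * k * h <= beta ->
  4 * k * beta <= h -> 0 <= d -> 5 * d <= 4 * k * beta ->
  {within `[0, +oo[, continuous px} -> {within `[0, +oo[, continuous py} ->
  {within `[0, +oo[, continuous qx} -> {within `[0, +oo[, continuous qy} ->
  (forall t : R, 0 < t ->
    [/\ is_derive t (1 : R) px (- 2 * h * px t - beta * qy t),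
        is_derive t (1 : R) py (- 2 * h * py t + beta * qx t),
        is_derive t (1 : R) qx (- beta * py t) &
        is_derive t (1 : R) qy (beta * px t)]) ->
  forall t : R, 0 <= t ->
  px t ^+ 2 + py t ^+ 2 + qx t ^+ 2 + qy t ^+ 2 <=
  5 / 3 * expR (- (d * t)) * (px 0 ^+ 2 + py 0 ^+ 2 + qx 0 ^+ 2 + qy 0 ^+ 2).
Proof.
move=> h0 beta0 k0 k8 kh kbeta d0 dk cpx cpy cqx cqy df t t0.
pose S t := px t ^+ 2 + py t ^+ 2 + qx t ^+ 2 + qy t ^+ 2.
pose G t := px t * qy t - py t * qx t.
pose E t := S t + 2 * k * G t.
pose F t := expR (d * t) * E t.
have GS u : `|2 * G u| <= S u.
  rewrite ler_norml /G /S; apply/andP; split.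
    have := sqr_ge0 (px u + qy u); have := sqr_ge0 (py u - qx u); lra.
  have := sqr_ge0 (px u - qy u); have := sqr_ge0 (py u + qx u); lra.
have S0 u : 0 <= S u by rewrite !addr_ge0// sqr_ge0.
(* The cross term is at most [k S <= S / 8]. The resulting ratio [9 / 7] is below the [5 / 3] of the
   statement. *)
have ES u : 7 / 8 * S u <= E u /\ E u <= 9 / 8 * S u.
  by have := GS u; rewrite ler_norml /E => /andP[? ?]; have := S0 u; split; nra.
pose E' t := - 4 * h * (px t ^+ 2 + py t ^+ 2) + 2 * k * (- 2 * h * G t -
   beta * (qx t ^+ 2 + qy t ^+ 2) + beta * (px t ^+ 2 + py t ^+ 2)).
have dF (u : R) : 0 < u -> is_derive u (1 : R) F (expR (d * u) * (d * E u + E' u)).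
  move=> u0; have [d1 d2 d3 d4] := df u u0.
  apply: is_derive_eq.
  rewrite /E' /E /S /G; set e := expR _.
  move: (px u) (py u) (qx u) (qy u) => x1 x2 y1 y2.
  by rewrite /GRing.scale/= mulr1; ring.
(* The indefinite term [- 4 k h G] is at most [h |p|^2 + k beta |q|^2], by [q1] and [q2]; this uses
   [4 k h <= beta]. Damping [k beta] of [|q|^2] survives, and more for [|p|^2] since
   [4 k beta <= h], while [5 d <= 4 k beta] gives [d E <= (9 / 10) k beta S]. *)
have E'le u : d * E u + E' u <= 0.
  have kh2 : (4 * k * h) ^+ 2 <= 4 * h * (k * beta).
    have : 0 <= 4 * k * h * (beta - 4 * k * h).
      by rewrite mulr_ge0// ?subr_ge0// !mulr_ge0.
    lra.
  have kb0 : 0 <= k * beta by rewrite mulr_ge0.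
  have q1 := quadratic_form_ge0 (px u) (qy u) h0 kb0 kh2.
  have kh2' : (- (4 * k * h)) ^+ 2 <= 4 * h * (k * beta) by rewrite sqrrN.
  have q2 := quadratic_form_ge0 (py u) (qx u) h0 kb0 kh2'.
  have [_ dE] := ES u.
  have d1 : d * E u <= d * (9 / 8 * S u) by rewrite ler_wpM2l.
  have d2 : 0 <= (4 * k * beta - 5 * d) * S u by rewrite mulr_ge0// subr_ge0.
  have d3 : 0 <= (h - 4 * k * beta) * (px u ^+ 2 + py u ^+ 2).
    by rewrite mulr_ge0 ?subr_ge0// addr_ge0// sqr_ge0.
  have d4 : 0 <= k * beta * (px u ^+ 2 + py u ^+ 2).
    by rewrite mulr_ge0// addr_ge0// sqr_ge0.
  have d5 : 0 <= k * beta * (qx u ^+ 2 + qy u ^+ 2).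
    by rewrite mulr_ge0// addr_ge0// sqr_ge0.
  have d6 : 0 <= h * (px u ^+ 2 + py u ^+ 2).
    by rewrite mulr_ge0// addr_ge0// sqr_ge0.
  move: d1 d2 d3 d4 d5 d6 q1 q2; rewrite /E' /S /G; lra.
have FF : F t <= F 0.
  apply: (@ler0_derive1_nincry _ F 0) => //.
  - by move=> x; rewrite in_itv/= andbT => x0; apply: ex_derive; exact: dF.
  - move=> x; rewrite in_itv/= andbT => x0; rewrite derive1E.
    have /@derive_val -> := dF x x0.
    by rewrite mulr_ge0_le0// expR_ge0.
  have ce : {within `[0, +oo[, continuous (fun t => expR (d * t))}.
    apply: continuous_subspaceT => x; apply: continuous_comp.
      by apply: cvgM; [exact: cvg_cst|exact: cvg_id].
    exact: continuous_expR.
  move=> x; rewrite /F /E /S /G.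
  have p1 := cpx x; have p2 := cpy x; have p3 := cqx x; have p4 := cqy x.
  apply: cvgM; first exact: ce.
  apply: cvgD.
    by apply: cvgD; [apply: cvgD; [apply: cvgD|]|]; rewrite expr2; exact: cvgM.
  apply: cvgM; first exact: cvg_cst.
  by apply: cvgB; exact: cvgM.
have := ES t; have := ES 0; rewrite -/(S t) -/(S 0) => -[_ E0] [Et _].
have : E t <= expR (- (d * t)) * E 0.
  by move: FF; rewrite /F mulr0 expR0 mul1r expRN -ler_pdivlMl ?expR_gt0.
have := expR_ge0 (- (d * t)); have := S0 0; have := S0 t.
set e := expR _; nra.
Qed.

Local Notation vec4 := (vec4 (R := R)).

(** The indices have the form in which [big_ord_recl] expands a sum over ['I_4]. *)
Let o1 : 'I_4 := lift ord0 ord0.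
Let o2 : 'I_4 := lift ord0 (lift ord0 ord0).
Let o3 : 'I_4 := lift ord0 (lift ord0 (lift ord0 ord0)).

Lemma symbol_mulE (a b rho theta : R) (xi : plane (R := R)) (v : vec4) :
  let h := 2^-1 * (enorm xi `^ (2 * rho) + enorm xi `^ (2 * theta)) in
  let A := symbol a b rho theta xi in
  let r := enorm xi in
  [/\ (A *m v) ord0 0 = Complex h 0 * (v ord0 0 + v o2 0) + Complex 0 (- (b * r)) * v ord0 0,
      (A *m v) o1 0 = Complex h 0 * (v o1 0 + v o3 0) + Complex 0 (- (a * r)) * v o1 0,
      (A *m v) o2 0 = Complex h 0 * (v ord0 0 + v o2 0) + Complex 0 (b * r) * v o2 0 &
      (A *m v) o3 0 = Complex h 0 * (v o1 0 + v o3 0) + Complex 0 (a * r) * v o3 0].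
Proof.
move=> h A r.
split; rewrite mxE !big_ord_recl big_ord0 /A /symbol !mxE/= -/h -/r -/o1 -/o2 -/o3;
  case: (v ord0 0) (v o1 0) (v o2 0) (v o3 0) => x0 y0 [x1 y1] [x2 y2] [x3 y3];
  apply/eqP; rewrite eq_complex ?mulr0n ?mulr1n ?(mulr0, mul0r, mulr1) /=;
  by apply/andP; split; apply/eqP; ring.
Qed.

(** The sum and the difference of the pair span the range and the kernel of the block of [B0]. By
    the parallelogram identity, going there and back changes both sides by the same factor 2. *)
Lemma complex_pair_decay (h beta k d : R) (z z' : R -> R[i]) :
  0 <= h -> 0 <= beta -> 0 <= k -> 8 * k <= 1 -> 4 * k * h <= beta ->
  4 * k * beta <= h -> 0 <= d -> 5 * d <= 4 * k * beta ->
  {within `[0, +oo[, continuous (fun t => complex.Re (z t))} ->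
  {within `[0, +oo[, continuous (fun t => complex.Im (z t))} ->
  {within `[0, +oo[, continuous (fun t => complex.Re (z' t))} ->
  {within `[0, +oo[, continuous (fun t => complex.Im (z' t))} ->
  let dz t := - (Complex h 0 * (z t + z' t) + Complex 0 (- beta) * z t) in
  let dz' t := - (Complex h 0 * (z t + z' t) + Complex 0 beta * z' t) in
  (forall t : R, 0 < t ->
    [/\ is_derive t (1 : R) (fun t => complex.Re (z t)) (complex.Re (dz t)),
        is_derive t (1 : R) (fun t => complex.Im (z t)) (complex.Im (dz t)),
        is_derive t (1 : R) (fun t => complex.Re (z' t)) (complex.Re (dz' t)) &
        is_derive t (1 : R) (fun t => complex.Im (z' t)) (complex.Im (dz' t))]) ->
  forall t : R, 0 <= t ->
  complex.Re (z t) ^+ 2 + complex.Im (z t) ^+ 2 +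
  (complex.Re (z' t) ^+ 2 + complex.Im (z' t) ^+ 2) <=
  5 / 3 * expR (- (d * t)) *
  (complex.Re (z 0) ^+ 2 + complex.Im (z 0) ^+ 2 +
   (complex.Re (z' 0) ^+ 2 + complex.Im (z' 0) ^+ 2)).
Proof.
move=> h0 beta0 k0 k8 kh kb d0 dk c1 c2 c3 c4 dz dz' dd t t0.
have cD (f g : R -> R) : {within `[0, +oo[, continuous f} ->
    {within `[0, +oo[, continuous g} ->
    {within `[0, +oo[, continuous (fun t => f t + g t)}.
  by move=> cf cg x; apply: cvgD; [exact: cf|exact: cg].
have cB (f g : R -> R) : {within `[0, +oo[, continuous f} ->
    {within `[0, +oo[, continuous g} ->
    {within `[0, +oo[, continuous (fun t => f t - g t)}.
  by move=> cf cg x; apply: cvgB; [exact: cf|exact: cg].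
have := @dissipative_pair_decay h beta k d
  (fun t => complex.Re (z t) + complex.Re (z' t))
  (fun t => complex.Im (z t) + complex.Im (z' t))
  (fun t => complex.Re (z t) - complex.Re (z' t))
  (fun t => complex.Im (z t) - complex.Im (z' t))
  h0 beta0 k0 k8 kh kb d0 dk (cD _ _ c1 c3) (cD _ _ c2 c4) (cB _ _ c1 c3)
  (cB _ _ c2 c4) _ t t0.
set e := expR _; set x := complex.Re _; set y := complex.Im _.
set x' := complex.Re _; set y' := complex.Im _.
set a := complex.Re _; set b := complex.Im _.
set a' := complex.Re _; set b' := complex.Im _.
have e0 : 0 <= e by exact: expR_ge0.
move=> H; suff : (x + x') ^+ 2 + (y + y') ^+ 2 + (x - x') ^+ 2 + (y - y') ^+ 2 <=
    5 / 3 * e * ((a + a') ^+ 2 + (b + b') ^+ 2 + (a - a') ^+ 2 + (b - b') ^+ 2).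
  lra.
apply: H => u u0; have [d1 d2 d3 d4] := dd u u0.
have E1 : complex.Re (dz u) = - h * (complex.Re (z u) + complex.Re (z' u))
    - beta * complex.Im (z u).
  by rewrite /dz; case: (z u) (z' u) => ? ? [? ?] /=; ring.
have E2 : complex.Im (dz u) = - h * (complex.Im (z u) + complex.Im (z' u))
    + beta * complex.Re (z u).
  by rewrite /dz; case: (z u) (z' u) => ? ? [? ?] /=; ring.
have E3 : complex.Re (dz' u) = - h * (complex.Re (z u) + complex.Re (z' u))
    + beta * complex.Im (z' u).
  by rewrite /dz'; case: (z u) (z' u) => ? ? [? ?] /=; ring.
have E4 : complex.Im (dz' u) = - h * (complex.Im (z u) + complex.Im (z' u))
    - beta * complex.Re (z' u).
  by rewrite /dz'; case: (z u) (z' u) => ? ? [? ?] /=; ring.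
rewrite E1 in d1; rewrite E2 in d2; rewrite E3 in d3; rewrite E4 in d4.
by split; apply: is_derive_eq; ring.
Qed.

(* The decay parameter of the pair with speed [a] also serves for the pair with
   speed [b > a], after replacing [k] by [k * (a / b)]. *)
Lemma solves_ode_decay (a b rho theta d k : R) (xi : plane (R := R)) (w0 : vec4)
    (w : R -> vec4) :
  let h := 2^-1 * (enorm xi `^ (2 * rho) + enorm xi `^ (2 * theta)) in
  let beta := a * enorm xi in
  0 < a -> a < b ->
  0 <= k -> 8 * k <= 1 -> 4 * k * h <= beta ->
  4 * k * beta <= h -> 0 <= d -> 5 * d <= 4 * k * beta ->
  solves_ode (symbol a b rho theta xi) w0 w ->
  forall t, 0 <= t -> vsq (w t) <= 5 / 3 * expR (- (d * t)) * vsq w0.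
Proof.
move=> h beta a0 ab k0 k8 kh kb d0 dk [w00 cw dw] t t0.
have h0 : 0 <= h by rewrite mulr_ge0// addr_ge0// powR_ge0.
have r0 : 0 <= enorm xi by exact: sqrtr_ge0.
have beta0 : 0 <= beta by rewrite mulr_ge0// ltW.
have b0 : 0 < b by lra.
have ab1 : a / b <= 1 by rewrite ler_pdivrMr// mul1r ltW.
have ab0 : 0 <= a / b by rewrite divr_ge0// ltW.
have dwE (u : R) (j : 'I_4) : 0 < u ->
    is_derive u (1 : R) (fun r => complex.Re (w r j 0))
      (complex.Re (- ((symbol a b rho theta xi *m w u) j 0))) /\
    is_derive u (1 : R) (fun r => complex.Im (w r j 0))
      (complex.Im (- ((symbol a b rho theta xi *m w u) j 0))).
  by move=> u0; have := dw u u0 j; rewrite mxE.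
have D1 := @complex_pair_decay h (b * enorm xi) (k * (a / b)) d
  (fun t => w t ord0 0) (fun t => w t o2 0) h0 (mulr_ge0 (ltW b0) r0)
  (mulr_ge0 k0 ab0).
have D2 := @complex_pair_decay h beta k d
  (fun t => w t o1 0) (fun t => w t o3 0) h0 beta0 k0 k8 kh kb d0 dk
  (cw _).1 (cw _).2 (cw _).1 (cw _).2.
(* The product of [k] and the speed is preserved, so the conditions on it carry over; the other two
   improve, since [k] decreases and the speed increases. *)
have kE : 4 * (k * (a / b)) * (b * enorm xi) = 4 * k * beta.
  by rewrite /beta; field; rewrite gt_eqF.
have {}D1 : complex.Re (w t ord0 0) ^+ 2 + complex.Im (w t ord0 0) ^+ 2 +
  (complex.Re (w t o2 0) ^+ 2 + complex.Im (w t o2 0) ^+ 2) <=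
  5 / 3 * expR (- (d * t)) *
  (complex.Re (w 0 ord0 0) ^+ 2 + complex.Im (w 0 ord0 0) ^+ 2 +
   (complex.Re (w 0 o2 0) ^+ 2 + complex.Im (w 0 o2 0) ^+ 2)).
  have kab : k * (a / b) <= k by rewrite ler_piMr.
  apply: D1 => //; try exact: (cw _).1; try exact: (cw _).2.
  - by lra.
  - have : 4 * (k * (a / b)) * h <= 4 * k * h by rewrite ler_wpM2r// ler_wpM2l.
    have : beta <= b * enorm xi by rewrite ler_wpM2r// ltW.
    lra.
  - by rewrite kE.
  - by rewrite kE.
  move=> u u0; have [E1 _ E3 _] := symbol_mulE a b rho theta xi (w u).
  have [d1 d2] := dwE u ord0 u0; have [d3 d4] := dwE u o2 u0.
  by rewrite E1 in d1 d2; rewrite E3 in d3 d4.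
have {}D2 : complex.Re (w t o1 0) ^+ 2 + complex.Im (w t o1 0) ^+ 2 +
  (complex.Re (w t o3 0) ^+ 2 + complex.Im (w t o3 0) ^+ 2) <=
  5 / 3 * expR (- (d * t)) *
  (complex.Re (w 0 o1 0) ^+ 2 + complex.Im (w 0 o1 0) ^+ 2 +
   (complex.Re (w 0 o3 0) ^+ 2 + complex.Im (w 0 o3 0) ^+ 2)).
  apply: D2 => // u u0; have [_ E1 _ E3] := symbol_mulE a b rho theta xi (w u).
  have [d1 d2] := dwE u o1 u0; have [d3 d4] := dwE u o3 u0.
  by rewrite E1 in d1 d2; rewrite E3 in d3 d4.
rewrite -w00 /vsq !big_ord_recl !big_ord0 -/o1 -/o2 -/o3.
move: D1 D2; set e := 5 / 3 * _; lra.
Qed.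

End Decay.

(** * Frequency weights *)

Section Weights.
Context {R : realType}.
Local Notation mu := (@lebesgue_measure R).
Local Notation plane := (plane (R := R)).

Lemma integral_inv_oneDsqr_scale (tau : R) : 0 < tau ->
  (\int[mu]_x ((1 + (tau * x) ^+ 2)^-1)%:E = (pi / tau)%:E)%E.
Proof.
move=> tau0.
have D0 (x : R) : 1 + (tau * x) ^+ 2 != 0 by rewrite gt_eqF// ltr_pwDl// sqr_ge0.
have cf : continuous (fun x : R => (1 + (tau * x) ^+ 2)^-1).
  move=> x; apply: cvgV => //; apply: cvgD; first exact: cvg_cst.
  by rewrite expr2; apply: cvgM; apply: cvgM; (exact: cvg_cst || exact: cvg_id).
have f0 (x : R) : 0 <= (1 + (tau * x) ^+ 2)^-1.
  by rewrite invr_ge0 addr_ge0// sqr_ge0.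
rewrite ge0_symfun_integralT//; last by move=> x /=; rewrite mulrN sqrrN.
have dF (x : R) : is_derive x (1 : R) (fun x => tau^-1 * atan (tau * x))
    (1 + (tau * x) ^+ 2)^-1.
  apply: is_derive_eq.
  by rewrite /GRing.scale/= mulr1; field; rewrite D0 gt_eqF.
have cF : continuous (fun x => tau^-1 * atan (tau * x)).
  move=> x; apply: differentiable_continuous; apply/derivable1_diffP.
  by apply: ex_derive; exact: dF.
rewrite (_ : [set x | 0 <= x] = `[0, +oo[%classic); last first.
  by apply/seteqP; split => x /=; rewrite in_itv/= andbT.
rewrite (@ge0_continuous_FTC2y _ _ (fun x => tau^-1 * atan (tau * x)) 0
  (tau^-1 * (pi / 2)))//.
- rewrite mulr0 atan0 mulr0 sube0 -EFinM; congr EFin; field.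
  by rewrite gt_eqF.
- exact: continuous_subspaceT.
- apply: cvgM; first exact: cvg_cst.
  have : (tau * x) @[x --> +oo] --> +oo.
    by apply: gt0_cvgMry => //; exact: cvg_id.
  by move=> h; apply: cvg_comp h _; exact: cvgy_atan.
- by apply: cvg_at_right_filter; exact: cF.
- by move=> x _; rewrite derive1E; have /@derive_val := dF x.
Qed.

Lemma measurable_inv_oneDsqr_scale (tau : R) :
  measurable_fun setT (fun x : R => (1 + (tau * x) ^+ 2)^-1).
Proof.
apply: continuous_measurable_fun => x; apply: cvgV.
  by rewrite gt_eqF// ltr_pwDl// sqr_ge0.
apply: cvgD; first exact: cvg_cst.
by rewrite expr2; apply: cvgM; apply: cvgM; (exact: cvg_cst || exact: cvg_id).
Qed.

Lemma integral_decay_plane (tau : R) : 0 < tau ->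
  (\int[mu2]_x (((1 + (tau * x.1) ^+ 2)^-1 * (1 + (tau * x.2) ^+ 2)^-1))%:E =
   ((pi / tau) ^+ 2)%:E)%E.
Proof.
move=> tau0; pose f (x : R) := (1 + (tau * x) ^+ 2)^-1.
have f0 x : 0 <= f x by rewrite invr_ge0 addr_ge0// sqr_ge0.
have mf : measurable_fun setT f by exact: measurable_inv_oneDsqr_scale.
rewrite /mu2 fubini_tonelli1; last 2 first.
- apply/measurable_EFinP; apply: measurable_funM.
    exact: (measurableT_comp mf measurable_fst).
  exact: (measurableT_comp mf measurable_snd).
- by move=> z; rewrite lee_fin mulr_ge0//; exact: f0.
rewrite /fubini_F/=.
under eq_integral => x _.
  under eq_integral do rewrite EFinM.
  rewrite ge0_integralZl//; last 3 first.
  - exact/measurable_EFinP.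
  - by move=> y _; rewrite lee_fin; exact: f0.
  - by rewrite lee_fin; exact: f0.
  rewrite integral_inv_oneDsqr_scale//.
  over.
rewrite ge0_integralZr//; last 3 first.
- exact/measurable_EFinP.
- by move=> y _; rewrite lee_fin; exact: f0.
- by rewrite lee_fin divr_ge0// ?pi_ge0// ltW.
by rewrite integral_inv_oneDsqr_scale// -EFinM expr2.
Qed.

(** From [exp x >= 1 + x] one gets [exp (c z) >= (c z / Q)^Q]. Taking [Q = q + 1] keeps the division
    by [Q] legitimate at [q = 0], and [z^q <= 1 + z^Q] returns to the exponent [q]. *)
Lemma powR_expR_bounded (q c : R) : 0 <= q -> 0 < c ->
  exists2 M, 0 < M & forall z, 0 <= z -> z `^ q * expR (- (c * z)) <= M.
Proof.
move=> q0 c0; pose Q := q + 1.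
have Q0 : 0 < Q by rewrite /Q; lra.
exists (1 + (Q / c) `^ Q); first by rewrite ltr_pwDl// powR_ge0.
move=> z z0.
have cz : 0 <= c * z by rewrite mulr_ge0// ltW.
have e1 : expR (- (c * z)) <= 1 by rewrite expR_le1 oppr_le0.
have e0 := expR_ge0 (- (c * z)).
have zq : z `^ q <= 1 + z `^ Q.
  have [z1|/ltW z1] := leP z 1.
    rewrite (@le_trans _ _ 1) ?lerDl ?powR_ge0//.
    by apply: le_trans (ge0_ler_powR q0 _ _ z1) _; rewrite ?nnegrE// powR1.
  by rewrite (@le_trans _ _ (z `^ Q)) ?lerDr// ler_powR// /Q lerDl.
have zQ : z `^ Q * expR (- (c * z)) <= (Q / c) `^ Q.
  rewrite expRN ler_pdivrMr ?expR_gt0//.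
  have -> : expR (c * z) = expR (c * z / Q) `^ Q.
    by rewrite -expRM; congr expR; field; rewrite gt_eqF.
  have Qc0 : 0 <= Q / c by rewrite divr_ge0 ?(ltW Q0)// ltW.
  rewrite -powRM ?expR_ge0//.
  apply: ge0_ler_powR; rewrite ?nnegrE//; first exact: ltW.
    by apply: mulr_ge0 => //; exact: expR_ge0.
  rewrite mulrC -ler_pdivrMr ?divr_gt0// invf_div.
  have := expR_ge1Dx (c * z / Q); lra.
apply: (@le_trans _ _ ((1 + z `^ Q) * expR (- (c * z)))).
  by rewrite ler_wpM2r.
by rewrite mulrDl mul1r lerD.
Qed.

Lemma powR_expR_powR_bounded (p al c : R) : 0 <= p -> 0 < al -> 0 < c ->
  exists2 M, 0 < M & forall y, 0 <= y -> y `^ p * expR (- (c * y `^ al)) <= M.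
Proof.
move=> p0 al0 c0.
have [M M0 HM] := powR_expR_bounded (divr_ge0 p0 (ltW al0)) c0.
exists M => // y y0; have := HM (y `^ al) (powR_ge0 _ _).
by rewrite -powRrM mulrCA divff ?mulr1// gt_eqF.
Qed.

(** In the scaled variable [y = tau r] the claim is that [y^(2s) (1 + y^2)^2 exp (- c y^al)] is
    bounded; the three terms of the expanded square give [M1 + 2 M2 + M3]. *)
Lemma low_weight_bound (s al c : R) : 0 <= s -> 0 < al -> 0 < c ->
  exists2 M, 0 < M & forall tau r, 0 < tau -> 0 <= r ->
  r `^ (2 * s) * expR (- (c * (tau * r) `^ al)) <=
  M * tau `^ (- (2 * s)) * ((1 + (tau * r) ^+ 2)^-1) ^+ 2.
Proof.
move=> s0 al0 c0.
have s20 : 0 <= 2 * s by rewrite mulr_ge0.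
have [M1 M10 H1] := powR_expR_powR_bounded s20 al0 c0.
have s22 : 0 <= 2 * s + 2 by rewrite addr_ge0.
have [M2 M20 H2] := powR_expR_powR_bounded s22 al0 c0.
have s24 : 0 <= 2 * s + 4 by rewrite addr_ge0.
have [M3 M30 H3] := powR_expR_powR_bounded s24 al0 c0.
exists (M1 + 2 * M2 + M3); first by lra.
move=> tau r tau0 r0; set y := tau * r.
have y0 : 0 <= y by rewrite mulr_ge0// ltW.
have yD : 0 < 1 + y ^+ 2 by rewrite ltr_pwDl// sqr_ge0.
have -> : r `^ (2 * s) = tau `^ (- (2 * s)) * y `^ (2 * s).
  rewrite /y powRM ?(ltW tau0)// mulrA -powRD ?addNr ?powRr0 ?mul1r//.
  by apply/implyP => _; rewrite gt_eqF.
set e := expR _.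
have -> : tau `^ (- (2 * s)) * y `^ (2 * s) * e =
    tau `^ (- (2 * s)) * (y `^ (2 * s) * e) by ring.
have -> : (M1 + 2 * M2 + M3) * tau `^ (- (2 * s)) * ((1 + y ^+ 2)^-1) ^+ 2 =
    tau `^ (- (2 * s)) * ((M1 + 2 * M2 + M3) / (1 + y ^+ 2) ^+ 2).
  by field; rewrite gt_eqF.
rewrite ler_wpM2l ?powR_ge0// ler_pdivlMr ?exprn_gt0//.
have yn (n : nat) : y `^ (2 * s + n%:R) = y `^ (2 * s) * y ^+ n.
  have [->|n0] := eqVneq n 0%N; first by rewrite addr0 expr0 mulr1.
  rewrite powRD ?powR_mulrn//; apply/implyP => /eqP ns; exfalso.
  have : 0 < n%:R :> R by rewrite ltr0n lt0n.
  by lra.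
have := H1 y y0; have := H2 y y0; have := H3 y y0.
rewrite (yn 2%N) (yn 4%N) -/e; lra.
Qed.

(** For large [r] the actual order of the rate is [r^(2 - 2 theta)], which is at least 1 because
    [theta <= 1]; the constant already yields exponential decay. *)
Definition decay_rate (al r : R) : R := if r <= 1 then r `^ al else 1.

Lemma decay_rate_le (a rho theta r : R) : 0 < a ->
  0 <= rho -> rho < 1 / 2 -> 1 / 2 < theta -> theta <= 1 -> 0 <= r ->
  let c := a ^+ 2 / (10 * (1 + a ^+ 2)) in
  let h := 2^-1 * (r `^ (2 * rho) + r `^ (2 * theta)) in
  let beta := a * r in
  exists k, [/\ 0 <= k, 8 * k <= 1, 4 * k * h <= beta, 4 * k * beta <= h &
    5 * (c * decay_rate (2 - 2 * rho) r) <= 4 * k * beta].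
Proof.
move=> a0 rho0 rho1 th1 th2 r0 c h beta.
have h0 : 0 <= h by rewrite mulr_ge0// addr_ge0// powR_ge0.
have beta0 : 0 <= beta by rewrite mulr_ge0// ltW.
(* At frequency 0 the speed and the rate vanish, so [k = 0] is taken there; otherwise the
   denominator [h^2 + beta^2] is positive. *)
have [r00|rn0] := eqVneq r 0.
  exists 0; split => //; rewrite ?mulr0 ?mul0r//.
  by rewrite /decay_rate r00 ler01 powR0 ?mulr0//; apply/eqP; lra.
have rp : 0 < r by rewrite lt_neqAle eq_sym rn0.
have bp : 0 < beta by rewrite mulr_gt0.
have D0 : 0 < h ^+ 2 + beta ^+ 2 by rewrite ltr_wpDl ?sqr_ge0// exprn_gt0.
exists (h * beta / (4 * (h ^+ 2 + beta ^+ 2))).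
have kE : 4 * (h * beta / (4 * (h ^+ 2 + beta ^+ 2))) =
    h * beta / (h ^+ 2 + beta ^+ 2) by field; rewrite gt_eqF.
rewrite kE; split.
- by apply: divr_ge0; apply: mulr_ge0 => //; exact: ltW.
- have -> : 8 * (h * beta / (4 * (h ^+ 2 + beta ^+ 2))) =
      2 * h * beta / (h ^+ 2 + beta ^+ 2) by field; rewrite gt_eqF.
  by rewrite ler_pdivrMr// mul1r; have := sqr_ge0 (h - beta); lra.
- rewrite mulrAC ler_pdivrMr//.
  have : 0 <= beta * beta ^+ 2 by rewrite mulr_ge0// sqr_ge0.
  lra.
- rewrite mulrAC ler_pdivrMr//.
  have : 0 <= h * h ^+ 2 by rewrite mulr_ge0// sqr_ge0.
  lra.
rewrite [leRHS]mulrAC ler_pdivlMr//.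
have ca : c * (10 * (1 + a ^+ 2)) = a ^+ 2.
  by rewrite /c; field; rewrite gt_eqF// ltr_pwDl// sqr_ge0.
have c0 : 0 <= c.
  by rewrite /c divr_ge0 ?sqr_ge0// mulr_ge0// addr_ge0// sqr_ge0.
set P := r `^ (2 * rho) in h h0 D0 kE *; set Q := r `^ (2 * theta) in h h0 D0 kE *.
have P0 : 0 < P by rewrite powR_gt0.
have Q0 : 0 < Q by rewrite powR_gt0.
(* [Z] is the dominant power, [r^(2 rho)] for [r <= 1] and [r^(2 theta)] beyond, and [x] is the
   rate. The condition [r <= Z] reflects [rho < 1/2 < theta]. In [c], the factor [10] is the 5 of
   the ODE estimate times the 2 lost in [Z <= 2 h]. *)
have key (Z x : R) : 0 < Z -> Z <= 2 * h -> h <= Z -> r ^+ 2 <= Z ^+ 2 ->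
    0 <= x -> x * Z <= r ^+ 2 ->
    5 * (c * x) * (h ^+ 2 + beta ^+ 2) <= h * beta * beta.
  move=> Z0 Zh hZ rZ x0 xZ.
  have hZ2 : h ^+ 2 <= Z ^+ 2 by rewrite ler_pXn2r ?nnegrE// ltW.
  have DZ : h ^+ 2 + beta ^+ 2 <= (1 + a ^+ 2) * Z ^+ 2.
    rewrite mulrDl mul1r; apply: lerD => //; rewrite /beta exprMn.
    by apply: ler_wpM2l => //; exact: sqr_ge0.
  apply: (@le_trans _ _ (5 * (c * x) * ((1 + a ^+ 2) * Z ^+ 2))).
    by apply: ler_wpM2l => //; apply: mulr_ge0 => //; exact: mulr_ge0.
  have -> : 5 * (c * x) * ((1 + a ^+ 2) * Z ^+ 2) =
      (c * (10 * (1 + a ^+ 2))) / 2 * Z * (x * Z) by field.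
  rewrite ca.
  have -> : h * beta * beta = a ^+ 2 * h * r ^+ 2 by rewrite /beta; ring.
  apply: (@le_trans _ _ (a ^+ 2 / 2 * Z * r ^+ 2)).
    apply: ler_wpM2l => //; apply: mulr_ge0; last exact: ltW.
    by apply: divr_ge0 => //; exact: sqr_ge0.
  apply: ler_wpM2r; first exact: sqr_ge0.
  rewrite -mulrA; apply: ler_wpM2l; first exact: sqr_ge0.
  by lra.
rewrite /decay_rate; case: ifPn => [r1|].
- have QP : Q <= P.
    by rewrite /P /Q ger_powR ?rp//; lra.
  apply: (key P) => //.
  + by rewrite /h; lra.
  + by rewrite /h; lra.
  + rewrite lerXn2r ?nnegrE//; first exact: ltW.
    by rewrite -[leLHS](powRr1 r0) /P ger_powR ?rp//; lra.
  + exact: powR_ge0.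
  + rewrite /P -powRD ?subrK ?powR_mulrn//.
    by apply/implyP => _.
- rewrite -ltNge => /ltW r1.
  have PQ : P <= Q by rewrite /P /Q ler_powR//; lra.
  apply: (key Q) => //.
  + by rewrite /h; lra.
  + by rewrite /h; lra.
  + rewrite lerXn2r ?nnegrE//; first exact: ltW.
    by rewrite -[leLHS](powRr1 r0) /Q ler_powR//; lra.
  + by rewrite mul1r -powR_mulrn// /Q ler_powR//; lra.
Qed.

End Weights.

(** * Low and high frequencies *)

Section Assembly.
Context {R : realType}.
Local Notation plane := (plane (R := R)).
Local Notation vec4 := (vec4 (R := R)).
Implicit Types (u w : plane -> vec4).

Lemma measurable_low_weight (s al c T : R) : measurable_fun setT
  (fun xi : plane => enorm xi `^ (2 * s) * expR (- (c * (T * enorm xi `^ al)))).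
Proof.
have mr : measurable_fun setT (@enorm R) by exact: measurable_enorm.
apply: measurable_funM; first exact: (measurableT_comp (measurable_powR (2 * s)) mr).
have mi : measurable_fun setT (fun xi : plane => - (c * (T * enorm xi `^ al))).
  apply: measurable_funN; apply: measurable_funM => //; apply: measurable_funM => //.
  exact: (measurableT_comp (measurable_powR al) mr).
exact: (measurableT_comp (@measurable_expR R) mi).
Qed.

(* [lam] makes both terms of [weighted_fourier_le] of the same order; [N] is the
   L^m norm of the data and tau^al = T. *)
Lemma optimal_splitting (s al m M tau N : R) : 0 < al -> 0 < m -> 0 < tau -> 0 < N ->
  let lam := tau `^ (- (2 / m)) * N in
  32 * (4 * (M * tau `^ (- (2 * s)) * (pi / tau) ^+ 2) *
          (lam `^ (1 - m) * N `^ m) ^+ 2 +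
        2 * (M * tau `^ (- (2 * s))) * (2 * pi) ^+ 2 * (lam `^ (2 - m) * N `^ m)) =
  32 * (4 * M * pi ^+ 2 + 2 * M * (2 * pi) ^+ 2) *
    ((tau `^ al) `^ (- (s / al) - (2 - m) / (m * al))) ^+ 2 * N ^+ 2.
Proof.
move=> al0 m0 tau0 N0 lam.
have ND (x : R) : N `^ (x - m) * N `^ m = N `^ x.
  by rewrite -powRD ?subrK//; apply/implyP => _; rewrite gt_eqF.
have tD (x y : R) : tau `^ x * tau `^ y = tau `^ (x + y).
  by rewrite -powRD//; apply/implyP => _; rewrite gt_eqF.
have t2 (x : R) : (tau `^ x) ^+ 2 = tau `^ (2 * x).
  by rewrite expr2 tD; congr powR; ring.
have E1 : lam `^ (1 - m) * N `^ m = tau `^ (- (2 / m) * (1 - m)) * N.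
  by rewrite powRM ?powR_ge0 ?(ltW N0)// -powRrM -mulrA ND (powRr1 (ltW N0)).
have E2 : lam `^ (2 - m) * N `^ m = tau `^ (- (2 / m) * (2 - m)) * N ^+ 2.
  by rewrite powRM ?powR_ge0 ?(ltW N0)// -powRrM -mulrA ND (powR_mulrn _ (ltW N0)).
rewrite E1 E2.
have TE : ((tau `^ al) `^ (- (s / al) - (2 - m) / (m * al))) ^+ 2 =
    tau `^ (- (2 * s) - 4 / m + 2).
  rewrite -powRrM t2; congr powR; field.
  by rewrite !gt_eqF.
(* Here and in [F2] the powers of [tau] add up to the same exponent [- 2 s - 4 / m + 2], which is
   the balance that fixes [lam]. *)
have F1 : tau `^ (- (2 * s)) * (pi / tau) ^+ 2 * (tau `^ (- (2 / m) * (1 - m)) * N) ^+ 2 =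
    pi ^+ 2 * tau `^ (- (2 * s) - 4 / m + 2) * N ^+ 2.
  have -> : (pi / tau) ^+ 2 = pi ^+ 2 * tau `^ (- 2).
    by rewrite powRN powR_mulrn ?(ltW tau0)// exprMn exprVn.
  rewrite exprMn t2.
  have -> : tau `^ (- (2 * s)) * (pi ^+ 2 * tau `^ (-2)) *
      (tau `^ (2 * (- (2 / m) * (1 - m))) * N ^+ 2) =
      pi ^+ 2 * (tau `^ (- (2 * s)) * tau `^ (-2) *
      tau `^ (2 * (- (2 / m) * (1 - m)))) * N ^+ 2 by ring.
  rewrite !tD; congr (_ * _ `^ _ * _); field.
  by rewrite gt_eqF.
have F2 : tau `^ (- (2 * s)) * (tau `^ (- (2 / m) * (2 - m)) * N ^+ 2) =
    tau `^ (- (2 * s) - 4 / m + 2) * N ^+ 2.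
  rewrite mulrA tD; congr (_ `^ _ * _); field.
  by rewrite gt_eqF.
rewrite TE; move: F1 F2.
move: (tau `^ (- (2 * s))) (tau `^ (- (2 / m) * (1 - m)))
  (tau `^ (- (2 / m) * (2 - m))) (tau `^ (- (2 * s) - 4 / m + 2)) => L1 L2 L3 L4.
move=> F1 F2.
have -> : 32 * (4 * (M * L1 * (pi / tau) ^+ 2) * (L2 * N) ^+ 2 +
    2 * (M * L1) * (2 * pi) ^+ 2 * (L3 * N ^+ 2)) =
    32 * (4 * M * (L1 * (pi / tau) ^+ 2 * (L2 * N) ^+ 2) +
          2 * M * (2 * pi) ^+ 2 * (L1 * (L3 * N ^+ 2))) by ring.
by rewrite F1 F2; ring.
Qed.

Lemma low_frequency_bound (s al c m : R) :
  0 <= s -> 0 < al -> 0 < c -> 1 <= m -> m <= 2 ->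
  exists2 C, 0 < C & forall u w (T A : R), is_fourier u w -> 0 < T -> 0 <= A ->
  (\int[mu2]_x (vnorm (u x) `^ m)%:E = A%:E)%E ->
  (\int[mu2]_xi (enorm xi `^ (2 * s) * expR (- (c * (T * enorm xi `^ al))) *
     vsq (w xi))%:E <=
   (C * (T `^ (- (s / al) - (2 - m) / (m * al))) ^+ 2 * (A `^ m^-1) ^+ 2)%:E)%E.
Proof.
move=> s0 al0 c0 m1 m2; have [M M0 HM] := low_weight_bound s0 al0 c0.
have m0 : 0 < m by lra.
pose C := 32 * (4 * M * pi ^+ 2 + 2 * M * (2 * pi) ^+ 2) : R.
have C0 : 0 < C.
  have := mulr_gt0 M0 (exprn_gt0 2 (pi_gt0 R)); rewrite /C; lra.
exists C => // u w T A uw T0 A0 uA.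
pose tau := T `^ al^-1.
have tau0 : 0 < tau by rewrite powR_gt0.
have tauT (r : R) : 0 <= r -> (tau * r) `^ al = T * r `^ al.
  move=> r0; rewrite powRM ?(ltW tau0)// /tau -powRrM mulVf ?gt_eqF//.
  by rewrite powRr1// ltW.
pose psi (xi : plane) := enorm xi `^ (2 * s) * expR (- (c * (T * enorm xi `^ al))).
have r0 (xi : plane) : 0 <= enorm xi by exact: sqrtr_ge0.
have psi0 xi : 0 <= psi xi by rewrite mulr_ge0 ?powR_ge0 ?expR_ge0.
have psiM xi : psi xi <= M * tau `^ (- (2 * s)) * ((1 + (tau * enorm xi) ^+ 2)^-1) ^+ 2.
  by rewrite /psi -tauT//; exact: HM.
have Mt0 : 0 <= M * tau `^ (- (2 * s)) by rewrite mulr_ge0 ?powR_ge0// ltW.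
have psiP xi : psi xi <= M * tau `^ (- (2 * s)).
  apply: le_trans (psiM xi) _; rewrite ler_piMr// exprn_ile1//.
    by rewrite invr_ge0 addr_ge0// sqr_ge0.
  by rewrite invf_le1 ?lerDl ?sqr_ge0// ltr_pwDl// sqr_ge0.
have mr : measurable_fun setT (@enorm R) by exact: measurable_enorm.
have mpsi : measurable_fun setT psi by exact: measurable_low_weight.
have psi1 : (\int[mu2]_x (psi x)%:E <= (M * tau `^ (- (2 * s)) * (pi / tau) ^+ 2)%:E)%E.
  rewrite EFinM -integral_decay_plane//.
  have mD : measurable_fun setT (fun x : plane =>
      (1 + (tau * x.1) ^+ 2)^-1 * (1 + (tau * x.2) ^+ 2)^-1).
    apply: measurable_funM.
      exact: (measurableT_comp (measurable_inv_oneDsqr_scale tau) measurable_fst).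
    exact: (measurableT_comp (measurable_inv_oneDsqr_scale tau) measurable_snd).
  rewrite -ge0_integralZl//; last 2 first.
  - exact/measurable_EFinP.
  - by move=> x _; rewrite lee_fin mulr_ge0// invr_ge0 addr_ge0// sqr_ge0.
  apply: ge0_le_integral => //.
  - by move=> x _; rewrite lee_fin.
  - exact/measurable_EFinP.
  - by apply: measurable_funeM; exact/measurable_EFinP.
  (* The squared radial factor dominates the product: [(1 + y1 + y2)^2 >= (1 + y1) (1 + y2)] for
     nonnegative [y1] and [y2]. *)
  move=> x _; rewrite -EFinM lee_fin (le_trans (psiM x))// ler_wpM2l//.
  have eE : enorm x ^+ 2 = x.1 ^+ 2 + x.2 ^+ 2.
    by rewrite sqr_sqrtr /dotp -!expr2// addr_ge0// sqr_ge0.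
  have y1 : 0 <= (tau * x.1) ^+ 2 by exact: sqr_ge0.
  have y2 : 0 <= (tau * x.2) ^+ 2 by exact: sqr_ge0.
  rewrite [(tau * enorm x) ^+ 2]exprMn eE mulrDr -!exprMn.
  rewrite exprVn -invfM lef_pV2 ?posrE.
  - nra.
  - by rewrite exprn_gt0//; lra.
  - by rewrite mulr_gt0//; lra.
pose N := A `^ m^-1.
have NA : A = N `^ m by rewrite /N -powRrM mulVf ?gt_eqF// powRr1.
(* For zero data the balanced threshold would be 0; any positive one works, since both contributions
   then vanish. *)
pose lam := if A == 0 then 1 else tau `^ (- (2 / m)) * N.
have lam0 : 0 < lam.
  rewrite /lam; case: eqVneq => // An0.
  by rewrite mulr_gt0 ?powR_gt0// lt_neqAle eq_sym An0.
have uA' : (\int[mu2]_x (vnorm (u x) `^ m)%:E <= A%:E)%E by rewrite uA.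
apply: le_trans (weighted_fourier_le uw m1 m2 lam0 uA' mpsi psi0 psiP psi1) _.
rewrite lee_fin -/N.
have [A00|An0] := eqVneq A 0.
  rewrite A00 !mulr0 expr0n/= !mulr0 addr0 mulr0 mulr_ge0 ?sqr_ge0//.
  by rewrite mulr_ge0 ?sqr_ge0// ltW.
have N0 : 0 < N by rewrite powR_gt0// lt_neqAle eq_sym An0.
have TE : T = tau `^ al by rewrite /tau -powRrM mulVf ?powRr1 ?(ltW T0) ?gt_eqF.
have lamE : lam = tau `^ (- (2 / m)) * N by rewrite /lam (negbTE An0).
rewrite [in leLHS]NA lamE /C TE.
clearbody tau; clearbody N; rewrite -optimal_splitting//.
Qed.

(** For [r <= 1] the exponent loses at most [c] because [r^al <= 1]; for [r > 1] the factor [exp c]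
    is used exactly. Bounding by a sum of two nonnegative weights lets each be integrated over the
    whole plane. *)
Lemma split_weight_le (s al c r t : R) :
  0 <= s -> 0 < al -> 0 <= c -> 0 <= r -> 0 <= t ->
  (r `^ s) ^+ 2 * expR (- (c * decay_rate al r * t)) <=
  expR c * (r `^ (2 * s) * expR (- (c * ((1 + t) * r `^ al))) +
            expR (- (c * (1 + t))) * ((1 + r ^+ 2) `^ (s / 2)) ^+ 2).
Proof.
move=> s0 al0 c0 r0 t0.
have rs : (r `^ s) ^+ 2 = r `^ (2 * s).
  by rewrite -powR_mulrn ?powR_ge0// -powRrM mulrC.
have p0 : 0 <= r `^ (2 * s) by exact: powR_ge0.
have q0 : 0 <= ((1 + r ^+ 2) `^ (s / 2)) ^+ 2 by exact: sqr_ge0.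
rewrite mulrDr /decay_rate; case: ifPn => [r1|].
  apply: (@le_trans _ _ (expR c * (r `^ (2 * s) * expR (- (c * ((1 + t) * r `^ al)))))).
    rewrite rs mulrCA ler_wpM2l// -expRD ler_expR.
    have : r `^ al <= 1.
      by apply: le_trans (ge0_ler_powR (ltW al0) _ _ r1) _; rewrite ?nnegrE// powR1.
    move=> /(ler_wpM2l c0); lra.
  by rewrite lerDl mulr_ge0 ?expR_ge0// mulr_ge0 ?expR_ge0.
rewrite -ltNge => r1.
apply: (@le_trans _ _ (expR c * (expR (- (c * (1 + t))) * ((1 + r ^+ 2) `^ (s / 2)) ^+ 2))).
  have -> : expR c * (expR (- (c * (1 + t))) * ((1 + r ^+ 2) `^ (s / 2)) ^+ 2) =
      ((1 + r ^+ 2) `^ (s / 2)) ^+ 2 * expR (- (c * 1 * t)).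
    by rewrite mulrA -expRD mulrC; congr (_ * expR _); ring.
  rewrite ler_wpM2r ?expR_ge0// lerXn2r ?nnegrE ?powR_ge0//.
  have -> : r `^ s = (r ^+ 2) `^ (s / 2).
    by rewrite -powR_mulrn// -powRrM; congr powR; field.
  apply: ge0_ler_powR; rewrite ?nnegrE ?addr_ge0 ?sqr_ge0 ?lerDr//.
  by rewrite divr_ge0.
by rewrite lerDr mulr_ge0 ?expR_ge0// mulr_ge0 ?expR_ge0.
Qed.

Lemma expR_le_powR (e c : R) : 0 <= e -> 0 < c ->
  exists2 C, 0 < C & forall T : R, 0 < T -> expR (- (c * T)) <= C * (T `^ (- e)) ^+ 2.
Proof.
move=> e0 c0; have e20 : 0 <= 2 * e by rewrite mulr_ge0.
have [M M0 HM] := powR_expR_bounded e20 c0.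
exists M => // T T0; have := HM T (ltW T0).
have -> : (T `^ (- e)) ^+ 2 = (T `^ (2 * e))^-1.
  rewrite -powR_mulrn ?powR_ge0// -powRrM -powRN; congr powR; ring.
by rewrite ler_pdivlMr ?powR_gt0// mulrC.
Qed.

Lemma fourierP u w : is_fourier u w -> is_fourier u (fourier u).
Proof. by move=> uw; rewrite /fourier; apply: xgetPex; exists w. Qed.

Lemma poweRV_lty (p : R) (x : \bar R) : 0 < p -> (0 <= x)%E ->
  (x `^ p^-1 < +oo)%E -> exists2 r : R, 0 <= r & x = r%:E.
Proof.
move=> p0; case: x => [r r0 _| |//]; first by exists r.
by rewrite /= invr_eq0 gt_eqF.
Qed.

Lemma measurable_weighted_vsq (h : plane -> R) u : measurable_fun setT h ->
  vmeasurable u -> measurable_fun setT (fun x => (h x * vsq (u x))%:E).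
Proof.
move=> mh mu; apply/measurable_EFinP; apply: measurable_funM => //.
exact: measurable_vsq.
Qed.

End Assembly.

Theorem theorem3p1 (R : realType) (a b rho theta s m : R)
  (ha : 0 < a) (hab : a < b)
  (hrho0 : 0 <= rho) (hrho : rho < 1 / 2)
  (htheta : 1 / 2 < theta) (htheta1 : theta <= 1)
  (hs : 0 <= s) (hm1 : 1 <= m) (hm2 : m <= 2) :
  exists2 C : R, 0 < C &
    forall (U0 : plane -> vec4) (U : R -> plane -> vec4),
      inH s U0 -> inL m U0 ->
      is_solution a b rho theta U0 U ->
      forall t : R, 0 <= t ->
        (dotHnorm s (U t) <=
         (C * (1 + t) `^ (- (s / (2 - 2 * rho))
                          - (2 - m) / (m * (2 - 2 * rho))))%:E
         * (Hnorm s U0 + Lnorm4 m U0))%E.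
Proof.
pose al := 2 - 2 * rho; have al0 : 0 < al by rewrite /al; lra.
pose c := a ^+ 2 / (10 * (1 + a ^+ 2)).
have c0 : 0 < c.
  by rewrite /c divr_gt0 ?exprn_gt0// mulr_gt0// ltr_pwDl// sqr_ge0.
have m0 : 0 < m by lra.
have e0 : 0 <= s / al + (2 - m) / (m * al).
  rewrite addr_ge0// divr_ge0// ?(ltW al0)//; first lra.
  by rewrite mulr_ge0// ltW.
have [C1 C10 low] := low_frequency_bound hs al0 c0 hm1 hm2.
have [C2 C20 high] := expR_le_powR e0 c0.
(* The factors come from the ODE estimate, from replacing [t] by [1 + t], and from low and high
   frequencies. The constant is the square root of [K] because the estimates concern squared
   norms. *)
pose K := 5 / 3 * expR c * (C1 + C2).
have K0 : 0 < K by rewrite /K mulr_gt0 ?mulr_gt0 ?expR_gt0//; lra.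
exists (Num.sqrt K); first by rewrite sqrtr_gt0.
move=> U0 U [U0L2 HU0] [_ LU0] [W0 [W [F0 FW ode]]] t t0.
rewrite -/al; set X := (1 + t) `^ _.
have T0 : 0 < 1 + t by lra.
have X0 : 0 <= X by exact: powR_ge0.
have F0' := fourierP F0; have Ft := FW t t0; have Ft' := fourierP Ft.
have [_ mW0 _] := F0; have [_ mf0 _] := F0'.
have [_ mWt _] := Ft; have [_ mft _] := Ft'.
have mr : measurable_fun setT (@enorm R) by exact: measurable_enorm.
pose g (xi : plane) := ((1 + enorm xi ^+ 2) `^ (s / 2)) ^+ 2.
have mg : measurable_fun setT g.
  apply: measurable_funX; apply: (measurableT_comp (measurable_powR (s / 2))).
  by apply: measurable_funD => //; exact: measurable_funX.
have g0 xi : 0 <= g xi by exact: sqr_ge0.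
pose f (xi : plane) := (enorm xi `^ s) ^+ 2.
have mf : measurable_fun setT f.
  by apply: measurable_funX; exact: (measurableT_comp (measurable_powR s) mr).
pose psi (xi : plane) := enorm xi `^ (2 * s) * expR (- (c * ((1 + t) * enorm xi `^ al))).
have mpsi : measurable_fun setT psi by exact: measurable_low_weight.
have psi0 xi : 0 <= psi xi by rewrite mulr_ge0 ?powR_ge0 ?expR_ge0.
have [A A0 EA] : exists2 A : R, 0 <= A & (\int[mu2]_x (vnorm (U0 x) `^ m)%:E = A%:E)%E.
  apply: (poweRV_lty m0); last by rewrite -Lnorm4E.
  by apply: integral_ge0 => x _; rewrite lee_fin powR_ge0.
have [J J0 EJ] : exists2 J : R, 0 <= J &
    (\int[mu2]_xi (g xi * vsq (fourier U0 xi))%:E = J%:E)%E.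
  have two0 : 0 < 2 :> R by [].
  apply: (poweRV_lty two0).
    by apply: integral_ge0 => x _; rewrite lee_fin mulr_ge0// vsq_ge0.
  move: HU0; rewrite /Hnorm Lnorm4_2E.
  by under eq_integral do rewrite vsqZ.
have HE : Hnorm s U0 = (Num.sqrt J)%:E.
  rewrite /Hnorm Lnorm4_2E; under eq_integral do rewrite vsqZ -/(g _).
  by rewrite EJ /= powR12_sqrt.
have LE : Lnorm4 m U0 = (A `^ m^-1)%:E by rewrite Lnorm4E EA.
(* The [H^s] norm refers to the chosen representative, the ODE to the [W0] of the solution; they
   agree almost everywhere. *)
have EJ' : (\int[mu2]_xi (g xi * vsq (W0 xi))%:E = J%:E)%E.
  rewrite -EJ; apply: ge0_ae_eq_integral => //.
  - exact: measurable_weighted_vsq.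
  - exact: measurable_weighted_vsq.
  - by move=> x _; rewrite lee_fin mulr_ge0// vsq_ge0.
  - by move=> x _; rewrite lee_fin mulr_ge0// vsq_ge0.
  - by apply: filterS (is_fourier_unique F0 F0') => xi -> _.
have lowW : (\int[mu2]_xi (psi xi * vsq (W0 xi))%:E <=
    (C1 * X ^+ 2 * (A `^ m^-1) ^+ 2)%:E)%E := low _ _ _ _ F0 T0 A0 EA.
have pv0 xi : 0 <= psi xi * vsq (W0 xi) by rewrite mulr_ge0// vsq_ge0.
have gv0 xi : 0 <= g xi * vsq (W0 xi) by rewrite mulr_ge0// vsq_ge0.
have E0 : 0 <= expR (- (c * (1 + t))) by exact: expR_ge0.
have dotE : (\int[mu2]_xi (f xi * vsq (fourier (U t) xi))%:E <=
    (K * X ^+ 2 * (Num.sqrt J + A `^ m^-1) ^+ 2)%:E)%E.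
  apply: (@le_trans _ _ (\int[mu2]_xi ((5 / 3 * expR c)%:E *
     ((psi xi * vsq (W0 xi))%:E + (expR (- (c * (1 + t))))%:E * (g xi * vsq (W0 xi))%:E)))%E).
    have EE x : ((5 / 3 * expR c)%:E * ((psi x * vsq (W0 x))%:E +
        (expR (- (c * (1 + t))))%:E * (g x * vsq (W0 x))%:E))%E =
        (5 / 3 * expR c * (psi x * vsq (W0 x) +
         expR (- (c * (1 + t))) * (g x * vsq (W0 x))))%:E by [].
    apply: ae_ge0_le_integral => //.
    - by move=> x _; rewrite lee_fin mulr_ge0 ?vsq_ge0// sqr_ge0.
    - exact: measurable_weighted_vsq.
    - move=> x _; rewrite EE lee_fin; apply: mulr_ge0.
        by rewrite mulr_ge0 ?expR_ge0.
      exact: addr_ge0 (pv0 x) (mulr_ge0 E0 (gv0 x)).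
    - apply: measurable_funeM; apply: emeasurable_funD.
        exact: measurable_weighted_vsq.
      by apply: measurable_funeM; exact: measurable_weighted_vsq.
    (* Off a null set the representatives at time [t] agree and the ODE holds at [xi]. There [k] may
       depend on [xi], while [c] does not. *)
    apply: filterS2 (is_fourier_unique Ft' Ft) ode => xi -> ode _.
    rewrite EE lee_fin.
    have r0 : 0 <= enorm xi by exact: sqrtr_ge0.
    have [k [k0 k8 kh kb kd]] := decay_rate_le ha hrho0 hrho htheta htheta1 r0.
    have d0 : 0 <= c * decay_rate al (enorm xi).
      rewrite mulr_ge0 ?(ltW c0)// /decay_rate; case: ifP => // _; exact: powR_ge0.
    have := solves_ode_decay ha hab k0 k8 kh kb d0 kd ode t0.
    move=> h; apply: (@le_trans _ _ (f xi * (5 / 3 * expR (- (c * decay_rate al (enorm xi) * t)) * vsq (W0 xi)))).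
      by rewrite ler_wpM2l// sqr_ge0.
    have := split_weight_le hs al0 (ltW c0) r0 t0; rewrite -/(f xi) -/(psi xi) -/(g xi).
    move=> /(ler_wpM2r (vsq_ge0 (W0 xi))); lra.
  rewrite ge0_integralZl//; last 2 first.
  - apply: emeasurable_funD.
      exact: measurable_weighted_vsq.
    by apply: measurable_funeM; exact: measurable_weighted_vsq.
  - move=> x _; rewrite -EFinM -EFinD lee_fin.
    exact: addr_ge0 (pv0 x) (mulr_ge0 E0 (gv0 x)).
  rewrite ge0_integralD//; last 4 first.
  - by move=> x _; rewrite lee_fin; exact: pv0.
  - exact: measurable_weighted_vsq.
  - by move=> x _; rewrite -EFinM lee_fin; exact: mulr_ge0 E0 (gv0 x).
  - by apply: measurable_funeM; exact: measurable_weighted_vsq.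
  rewrite ge0_integralZl//; last 2 first.
  - exact: measurable_weighted_vsq.
  - by move=> x _; rewrite lee_fin; exact: gv0.
  rewrite EJ'.
  apply: (@le_trans _ _ ((5 / 3 * expR c)%:E *
      ((C1 * X ^+ 2 * (A `^ m^-1) ^+ 2)%:E + (expR (- (c * (1 + t))))%:E * J%:E))%E).
    apply: lee_wpmul2l; first by rewrite lee_fin mulr_ge0 ?expR_ge0.
    exact: leeD.
  rewrite (_ : (_ * _)%E = (5 / 3 * expR c * (C1 * X ^+ 2 * (A `^ m^-1) ^+ 2 +
    expR (- (c * (1 + t))) * J))%:E)//.
  rewrite lee_fin (_ : K * X ^+ 2 * _ = 5 / 3 * expR c *
    ((C1 + C2) * X ^+ 2 * (Num.sqrt J + A `^ m^-1) ^+ 2)); last by rewrite /K; ring.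
  apply: ler_wpM2l; first by rewrite mulr_ge0 ?expR_ge0.
  have hX : expR (- (c * (1 + t))) <= C2 * X ^+ 2.
    by have := high _ T0; rewrite opprD.
  (* What is left is that a sum of squares of the two norms is at most the square of their sum, with
     nonnegative coefficients. *)
  rewrite -{1}(sqr_sqrtr J0).
  have n0 : 0 <= Num.sqrt J by exact: sqrtr_ge0.
  have p0 : 0 <= A `^ m^-1 by exact: powR_ge0.
  have h1 := ler_wpM2r (sqr_ge0 (Num.sqrt J)) hX.
  have h2 : 0 <= C1 * X ^+ 2 * Num.sqrt J ^+ 2 by rewrite !mulr_ge0 ?sqr_ge0 ?(ltW C10).
  have h3 : 0 <= C1 * X ^+ 2 * (Num.sqrt J * A `^ m^-1).
    by rewrite !mulr_ge0 ?sqr_ge0 ?(ltW C10).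
  have h4 : 0 <= C2 * X ^+ 2 * (A `^ m^-1) ^+ 2 by rewrite !mulr_ge0 ?sqr_ge0 ?(ltW C20).
  have h5 : 0 <= C2 * X ^+ 2 * (Num.sqrt J * A `^ m^-1).
    by rewrite !mulr_ge0 ?sqr_ge0 ?(ltW C20).
  move: h1 h2 h3 h4 h5; lra.
rewrite HE LE -EFinD -EFinM /dotHnorm Lnorm4_2E.
under eq_integral do rewrite vsqZ -/(f _).
have I0 : (0 <= \int[mu2]_xi (f xi * vsq (fourier (U t) xi))%:E)%E.
  by apply: integral_ge0 => x _; rewrite lee_fin mulr_ge0 ?vsq_ge0// sqr_ge0.
case: (integral _ _ _) I0 dotE => [r| |]//=; rewrite !lee_fin => r0 rK.
rewrite powR12_sqrt//.
apply: le_trans (ler_wsqrtr rK) _.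
have -> : K * X ^+ 2 * (Num.sqrt J + A `^ m^-1) ^+ 2 =
    (Num.sqrt K * X * (Num.sqrt J + A `^ m^-1)) ^+ 2.
  by rewrite !exprMn sqr_sqrtr ?(ltW K0).
rewrite sqrtr_sqr ger0_norm//; apply: mulr_ge0.
  by apply: mulr_ge0 => //; exact: sqrtr_ge0.
by apply: addr_ge0; [exact: sqrtr_ge0|exact: powR_ge0].
Qed.
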